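(* Let $p>1$, $\frac1p+\frac1q=1$, $0<\gamma\le 1$, $2<\alpha\le 3$, $\beta>0$, let $m\ge 3$ be an integer, and let $0<\xi_1<\xi_2<\dots<\xi_{m-2}<+\infty$. Assume: (i) $\eta_i>0$ for $i=1,\dots,m-2$ and $0<\sum_{i=1}^{m-2}\eta_i\xi_i^{\alpha+\beta-2}<\Gamma(\alpha+\beta-1)$; (ii) $f:[0,+\infty)\times[0,+\infty)\times[0,+\infty)\to[0,+\infty)$ is continuous, $f(t,0,0)\not\equiv 0$ on any subinterval of $(0,+\infty)$, and $f(t,(1+t^{\alpha-1})u,(1+t^{\alpha-1})v)$ is bounded (over $t\in[0,+\infty)$) when $u,v$ are bounded; (iii) $a:[0,+\infty)\to[0,+\infty)$ is not identically zero on any closed subinterval of $[0,+\infty)$ and $$\int_0^{+\infty}\phi_q\left(\frac{1}{\Gamma(\gamma)}\int_0^s(s-\tau)^{\gamma-1}a(\tau)\,d\tau\right)ds<+\infty .$$ For $\delta>0$ put $$B_\delta=\sup\{f(t,(1+t^{\alpha-1})u,(1+t^{\alpha-1})v):(t,u,v)\in[0,+\infty)\times[0,\delta]\times[0,\delta]\},$$ $$L=\frac{\Gamma(\alpha+\beta-1)}{\Gamma(\alpha)\left[\Gamma(\alpha+\beta-1)-\sum_{i=1}^{m-2}\eta_i\xi_i^{\alpha+\beta-2}\right]},$$ $$M=L(\alpha-1)\phi_q(B_\delta)\int_0^{+\infty}\phi_q\left(\frac{1}{\Gamma(\gamma)}\int_0^s(s-\tau)^{\gamma-1}a(\tau)\,d\tau\right)ds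 .$$ If there exists a constant $\delta>0$ such that $\frac{\delta}{M}\ge 1$, then the boundary value problem $$\begin{cases} D_{0^+}^{\gamma}\left(\phi_p\left(D_{0^+}^{\alpha}u(t)\right)\right)+a(t)f(t,u(t),u'(t))=0,\quad t\in[0,+\infty),\\ u(0)=u'(0)=0,\\ \lim_{t\to+\infty}D_{0^+}^{\alpha-1}u(t)=\sum_{i=1}^{m-2}\eta_i I_{0^+}^{\beta}u'(\xi_i),\qquad D_{0^+}^{\alpha}u(t)|_{t=0}=0\end{cases}$$ has a positive solution $u=u(t)$ such that $$0\le\frac{u(t)}{1+t^{\alpha-1}}\le\delta,\qquad 0\le\frac{u'(t)}{1+t^{\alpha-1}}\le\delta,\qquad t\in[0,+\infty).$$
   Context: For $r>1$, $\phi_r(s)=|s|^{r-2}s$ (with $\phi_r(0)=0$); thus $(\phi_p)^{-1}=\phi_q$ when $\frac1p+\frac1q=1$. $\Gamma$ is the Euler gamma function. The Riemann–Liouville fractional integral of order $\nu>0$ is $I_{0^+}^{\nu}g(t)=\frac{1}{\Gamma(\nu)}\int_0^t(t-s)^{\nu-1}g(s)\,ds$, $t>0$. The Riemann–Liouville fractional derivative of order $\nu>0$ is $D_{0^+}^{\nu}g(t)=\frac{1}{\Gamma(n-\nu)}\left(\frac{d}{dt}\right)^n\int_0^t\frac{g(s)}{(t-s)^{\nu-n+1}}\,ds$ with $n=[\nu]+1$, where $[\nu]$ is the integer part of $\nu$.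
   Formalization: The weight a is assumed to have finite, continuous fractional integral of order γ on [0,∞) and not to vanish a.e. on any interval; the equation holds for a.e. t and wherever a is continuous. As printed it fails, e.g. a=t^{-γ} near 0 with γ<1, f(0,0,0)>0. *)

(* Defs.v *)
From HB Require Import structures.
From mathcomp Require Import all_boot all_order all_algebra.
From mathcomp Require Import all_classical all_reals all_analysis.

Set Implicit Arguments.
Unset Strict Implicit.
Unset Printing Implicit Defensive.

Import Order.TTheory GRing.Theory Num.Theory.
Import numFieldNormedType.Exports.

Local Open Scope classical_set_scope.
Local Open Scope ring_scope.

Section FractionalCalculus.
Context {R : realType}.
Implicit Types (g : R -> R) (r s t nu x : R).

Local Notation mu := (@lebesgue_measure R).

Definition phi r s : R := `|s| `^ (r - 2) * s.

Definition Gamma x : R :=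
  \int[mu]_(t in `]0, +oo[) (t `^ (x - 1) * expR (- t)).

(* Functions on the half line [0, +oo) are represented by functions R -> R
   whose values at negative points are never used.  Their derivatives are taken
   relatively to [0, +oo): two-sided at t > 0 (see [hderiveE]), from the right
   at t = 0.  As [lim] is total, [hderive g t] is only meaningful together with
   [hderivable g t]. *)
Definition hquot g t : R -> R := fun h => h^-1 *: (g (h + t) - g t).

Definition hderivable g t : Prop :=
  cvg (hquot g t h @[h --> within [set h : R | 0 <= h + t] 0^']).

Definition hderive g t : R :=
  lim (hquot g t h @[h --> within [set h : R | 0 <= h + t] 0^']).

Lemma within_hquot t : 0 < t ->
  within [set h : R | 0 <= h + t] (0 : R)^' = (0 : R)^'.
Proof.
move=> t0; apply/seteqP; split => A; last first.
  by move=> A0; rewrite /within/=; apply: filterS A0 => h Ah _.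
rewrite /within/= => wA.
have t0' : \forall h \near (0 : R)^', - t < h.
  by apply: nbhs_dnbhs; apply: lt_nbhsr; rewrite oppr_lt0.
apply: filterS2 wA t0' => h Ah th; apply: Ah.
by rewrite -lerBlDr sub0r ltW.
Qed.

Lemma hderivableE g t : 0 < t -> hderivable g t <-> derivable g t 1.
Proof.
move=> t0; rewrite /hderivable /derivable within_hquot//.
rewrite (_ : hquot g t =
  fun h => h^-1 *: ((g \o pseudometric_normed_Zmodule.shift t) (h *: 1) - g t))//.
by apply/funext => h; rewrite /hquot /= scaler1.
Qed.

Lemma hderiveE g t : 0 < t -> hderive g t = derive1 g t.
Proof. by move=> t0; rewrite /hderive within_hquot. Qed.

(* [g] is [n] times differentiable at [t] (relatively to [0, +oo)). *)
Fixpoint hnderivable n g t : Prop :=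
  if n is k.+1 then
    (\forall s \near within [set s : R | 0 <= s] (nbhs t), hnderivable k g s)
    /\ hderivable (iter k hderive g) t
  else True.

Definition RLint_exists nu g t : Prop :=
  mu.-integrable `[0, t] (fun s => ((t - s) `^ (nu - 1) * g s)%:E).

Definition RLint nu g t : R :=
  (Gamma nu)^-1 * \int[mu]_(s in `[0, t]) ((t - s) `^ (nu - 1) * g s).

Definition RLorder nu : nat := (Num.truncn nu).+1.

Definition RLkernel nu g t s : R :=
  g s / (t - s) `^ (nu - (RLorder nu)%:R + 1).

Definition RLprimitive nu g t : R :=
  \int[mu]_(s in `[0, t]) RLkernel nu g t s.

Definition RLderive_exists nu g t : Prop :=
  (forall x, 0 <= x -> mu.-integrable `[0, x] (EFin \o RLkernel nu g x)) /\
  hnderivable (RLorder nu) (RLprimitive nu g) t.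

Definition RLderive nu g t : R :=
  (Gamma ((RLorder nu)%:R - nu))^-1 *
  iter (RLorder nu) hderive (RLprimitive nu g) t.

End FractionalCalculus.

Section BoundaryValueProblem.
Context {R : realType}.

Local Notation mu := (@lebesgue_measure R).

Variables (p gamma alpha beta : R) (k : nat) (xi eta : 'I_k -> R).
Variables (a : R -> R) (f : R -> R -> R -> R).

Definition equation_at (u : R -> R) (t : R) : Prop :=
  let g := fun s => phi p (RLderive alpha u s) in
  RLderive_exists gamma g t /\
  RLderive gamma g t + a t * f t (u t) (hderive u t) = 0.

(* The weight [a] need not be continuous, so the equation is required almost
   everywhere on [0, +oo), and moreover at every point where [a] is continuous
   (hence everywhere on [0, +oo) when [a] is continuous there). *)
Definition is_solution (u : R -> R) : Prop :=
  [/\ forall t : R, 0 <= t ->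
        [/\ hderivable u t, RLderive_exists alpha u t
          & RLderive_exists (alpha - 1) u t],
      {ae mu, forall t : R, 0 <= t -> equation_at u t}
      /\ (forall t : R, 0 <= t ->
            a s @[s --> within [set s : R | 0 <= s] (nbhs t)] --> a t ->
            equation_at u t),
      u 0 = 0 /\ hderive u 0 = 0,
      (forall i, RLint_exists beta (hderive u) (xi i)) /\
      RLderive (alpha - 1) u t @[t --> +oo] -->
        \sum_(i < k) eta i * RLint beta (hderive u) (xi i)
    & RLderive alpha u 0 = 0].

Definition is_positive_solution (u : R -> R) : Prop :=
  is_solution u /\ forall t : R, 0 < t -> 0 < u t.

End BoundaryValueProblem.

Section Constants.
Context {R : realType}.

Local Notation mu := (@lebesgue_measure R).

Definition Bsup (alpha : R) (f : R -> R -> R -> R) (delta : R) : R :=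
  sup [set y | exists t u v : R,
    [/\ 0 <= t, 0 <= u <= delta, 0 <= v <= delta &
        y = f t ((1 + t `^ (alpha - 1)) * u) ((1 + t `^ (alpha - 1)) * v)]].

Definition Lconst (alpha beta : R) (k : nat) (xi eta : 'I_k -> R) : R :=
  Gamma (alpha + beta - 1) /
  (Gamma alpha * (Gamma (alpha + beta - 1)
                  - \sum_(i < k) eta i * xi i `^ (alpha + beta - 2))).

Definition Mconst (q gamma alpha beta : R) (k : nat) (xi eta : 'I_k -> R)
    (a : R -> R) (f : R -> R -> R -> R) (delta : R) : R :=
  Lconst alpha beta xi eta * (alpha - 1) * phi q (Bsup alpha f delta) *
  \int[mu]_(s in `[0, +oo[) phi q (RLint gamma a s).

End Constants.

(* Main.v *)
(* With [h = - D^alpha u], the conditions at 0 give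
   [u' = c t^(alpha-2) / Gamma (alpha-1) - I^(alpha-1) h], the equation gives
   [h = phi_q (I^gamma (a f(., u, u')))], and the condition at infinity is an
   affine equation between [c] and [h] in which [c] can be isolated.  The map
   [u' |-> h |-> u'] is of Volterra type: with a delay [e > 0] in [I^(alpha-1)],
   finitely many iterations from 0 compute its fixed point on a bounded interval,
   for every [c].  This fixed point depends continuously on [c], and after
   truncating [f] all the functions [h] lie below a fixed integrable function, so
   the intermediate value theorem yields [c] satisfying the condition at infinity.
   As [e -> 0], the derivatives [u'] are uniformly Hoelder continuous of exponent
   [alpha - 2], hence converge pointwise along a subsequence, and by dominated
   convergence the limit is a fixed point without delay.  Since
   [0 <= c <= delta Gamma (alpha-1)] by the hypothesis on [delta], the limit obeys
   the required bounds, and in particular the truncation of [f] is not active.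
   As [a] may be unbounded, the continuity of [I^gamma (a g)] for bounded [g] is
   deduced from that of [I^gamma a] by an argument in the style of Scheffe. *)
Require Import Defs.
From mathcomp Require Import all_boot all_order all_algebra.
From mathcomp Require Import all_classical all_reals all_analysis.
From mathcomp Require Import measurable_realfun ring lra.

Set Implicit Arguments.
Unset Strict Implicit.
Unset Printing Implicit Defensive.

Import Order.TTheory GRing.Theory Num.Theory.
Import numFieldNormedType.Exports.

Local Open Scope classical_set_scope.
Local Open Scope ring_scope.

(** * Gamma and Beta integrals *)

Section AffineSubstitution.
Context {R : realType}.
Local Notation mu := (@lebesgue_measure R).

(** Since [f] is only continuous, the equation without delay may have several solutions for one c,
    and there would be no function of c for the intermediate value theorem; the delay restores
    uniqueness. A single real unknown then takes the place of a fixed-point theorem in a function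
    space. Nonnegativity of u' is not visible on a difference of two terms. It comes from c >= int
    h, which holds for the c isolated from the condition at infinity because the sum in (i) is below
    Gamma (alpha + beta - 1). The same isolation with h replaced by its majorant gives c <= M Gamma
    (alpha - 1): this is the origin of L and M. Strict positivity of u comes from the equality case
    of the kernel inequality behind its nonnegativity. Power kernels are extended by 0 to the whole
    line, so that the semigroup law of fractional integrals becomes an application of Tonelli and of
    the Beta integral. *)

Lemma measurable_affine (r b : R) :
  measurable_fun [set: R] (fun x : R => r * x + b).
Proof. by apply: measurable_funD => //; apply: measurable_funM. Qed.

(** The image of Lebesgue measure under the affine map, scaled by [r], gives every interval ]c, d]
    its length, so it is Lebesgue measure by uniqueness. *)
Lemma ge0_integral_affine (r b : R) (f : R -> \bar R) : 0 < r ->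
  measurable_fun setT f -> (forall x, (0 <= f x)%E) ->
  (\int[mu]_x f x = r%:E * \int[mu]_x f (r * x + b)%R)%E.
Proof.
move=> r0 mf f0.
pose phi (x : measurableTypeR R) : measurableTypeR R := r * x + b.
have mphi : measurable_fun setT phi by exact: measurable_affine.
pose nu_ := mscale (NngNum (ltW r0))
  (pushforward (mu : {measure set (measurableTypeR R) -> \bar R}) phi).
pose nu := nu_ mphi.
have nuE A : measurable A -> mu A = nu A.
  apply: lebesgue_measure_unique => _ [[c d] _ <-].
  have pre : phi @^-1` `]c, d]%classic = `](c - b) / r, (d - b) / r]%classic.
    apply/seteqP; split=> x /=; rewrite !in_itv/= /phi;
      by rewrite ltr_pdivrMr// ler_pdivlMr// ltrBlDr lerBrDr ![x * r]mulrC.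
  transitivity (r%:E * mu `]((c - b) / r)%R, ((d - b) / r)%R]%classic)%E; last first.
    by rewrite -pre.
  rewrite !lebesgue_measure_itv/= !lte_fin ltr_pM2r ?invr_gt0//.
  rewrite ltrD2r; case: ifPn => _; last by rewrite mule0.
  rewrite -!EFinB -EFinM; congr EFin; field; exact: lt0r_neq0.
rewrite (_ : \int[mu]_x f x = \int[nu]_x f x)%E; last first.
  by apply: eq_measure_integral => A mA _; exact: nuE.
rewrite /nu /nu_ ge0_integral_mscale//=.
by rewrite ge0_integral_pushforward.
Qed.

Lemma ge0_integral_shift (b : R) (f : R -> \bar R) :
  measurable_fun setT f -> (forall x, (0 <= f x)%E) ->
  (\int[mu]_x f (x + b)%R = \int[mu]_x f x)%E.
Proof.
move=> mf f0; rewrite [RHS](@ge0_integral_affine 1 b)// mul1e.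
by under [RHS]eq_integral do rewrite mul1r.
Qed.

End AffineSubstitution.

Section Kernel.
Context {R : realType}.
Local Notation mu := (@lebesgue_measure R).

(* The truncated power [t_+ ^ (x - 1)]: with it a Riemann-Liouville integral is
   a convolution over the whole line.  The test [0 < t] is needed because
   [powR] is 1 on negative reals. *)
Definition krn (x t : R) : R := if 0 < t then t `^ (x - 1) else 0.

Lemma krn_ge0 x t : 0 <= krn x t.
Proof. by rewrite /krn; case: ifP => // _; exact: powR_ge0. Qed.

Lemma krnE x t : 1 < x -> 0 <= t -> krn x t = t `^ (x - 1).
Proof.
move=> x1; rewrite /krn le_eqVlt => /predU1P[<-|->//].
by rewrite ltxx powR0// subr_eq0 gt_eqF.
Qed.

Lemma measurable_krn x : measurable_fun [set: R] (krn x).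
Proof.
apply: measurable_fun_if => //.
- exact: measurable_fun_ltr.
- by apply: measurable_funS (measurable_powR _).
Qed.

Lemma measurable_krnB x t : measurable_fun [set: R] (fun s => krn x (t - s)).
Proof.
by apply: measurableT_comp; [exact: measurable_krn | exact: measurable_funB].
Qed.

(* At [t = 1] this is the Beta function; it is [\bar R]-valued so that Tonelli
   applies before finiteness is known. *)
Definition krnconv (x y t : R) : \bar R :=
  (\int[mu]_s (krn x (t - s) * krn y s)%:E)%E.

Lemma krnconv_ge0 x y t : (0 <= krnconv x y t)%E.
Proof. by apply: integral_ge0 => s _; rewrite lee_fin mulr_ge0 ?krn_ge0. Qed.

(** Homogeneity: for t > 0 the substitution s -> t s pulls out the power of t and leaves the Beta
    integral. For t <= 0 the two factors have disjoint supports. *)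
Lemma krnconvE x y t : krnconv x y t = (krnconv x y 1 * (krn (x + y) t)%:E)%E.
Proof.
have mk : measurable_fun [set: R] (fun s => (krn x (t - s) * krn y s)%:E).
  apply/measurable_EFinP/measurable_funM; [exact: measurable_krnB|].
  exact: measurable_krn.
have mk1 : measurable_fun [set: R] (fun s => (krn x (1 - s) * krn y s)%:E).
  apply/measurable_EFinP/measurable_funM; [exact: measurable_krnB|].
  exact: measurable_krn.
case: (ltP 0 t) => t0; last first.
  rewrite [krn (x + y) t]/krn ltNge t0/= mule0 /krnconv integral0_eq// => s _.
  rewrite /krn; case: (ltP 0 s) => [s0|]; last by rewrite mulr0.
  by rewrite subr_gt0 ltNge (le_trans t0 (ltW s0))/= mul0r.
rewrite /krnconv (@ge0_integral_affine _ t 0)//; last first.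
  by move=> s; rewrite lee_fin mulr_ge0 ?krn_ge0.
under eq_integral => s _.
  have -> : krn x (t - (t * s + 0)) * krn y (t * s + 0) =
      (t `^ (x - 1) * t `^ (y - 1)) * (krn x (1 - s) * krn y s).
    rewrite addr0 (_ : t - t * s = t * (1 - s)); last by ring.
    rewrite /krn !pmulr_rgt0//.
    case: ifP => s1; last by rewrite !mul0r mulr0.
    case: ifP => s0; last by rewrite !mulr0.
    by rewrite !powRM ?ltW//; ring.
  rewrite EFinM; over.
rewrite ge0_integralZl//=; last 2 first.
- by move=> s _; rewrite lee_fin mulr_ge0 ?krn_ge0.
- by rewrite lee_fin mulr_ge0 ?powR_ge0.
rewrite muleA muleC; congr (_ * _)%E; rewrite -EFinM /krn t0; congr EFin.
rewrite -powRD; last by rewrite (gt_eqF t0) implybT.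
rewrite -{1}(powRr1 (ltW t0)) -powRD; last by rewrite (gt_eqF t0) implybT.
by congr (_ `^ _); ring.
Qed.

Definition eGamma (x : R) : \bar R := (\int[mu]_s (krn x s * expR (- s))%:E)%E.

Lemma eGamma_ge0 x : (0 <= eGamma x)%E.
Proof.
by apply: integral_ge0 => s _; rewrite lee_fin mulr_ge0 ?krn_ge0 ?expR_ge0.
Qed.

(** Tonelli in the variables s and w, where w is the sum of the two arguments: the exponentials
    combine to [expR (- w)], and the integral over s is [krnconv x y w]. *)
Lemma eGamma_Beta x y :
  (eGamma x * eGamma y = krnconv x y 1 * eGamma (x + y))%E.
Proof.
have me : measurable_fun [set: R] (fun s : R => expR (- s)).
  by apply: measurableT_comp.
have mkr z : measurable_fun [set: R] (fun s : R => krn z s * expR (- s)).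
  by apply: measurable_funM => //; exact: measurable_krn.
have mke z : measurable_fun [set: R] (fun s : R => (krn z s * expR (- s))%:E).
  exact/measurable_EFinP.
have ke0 z s : (0 <= (krn z s * expR (- s))%:E)%E.
  by rewrite lee_fin mulr_ge0 ?krn_ge0 ?expR_ge0.
pose f (z : R * R) : \bar R :=
  ((krn x (z.2 - z.1) * expR (- (z.2 - z.1))) * (krn y z.1 * expR (- z.1)))%:E.
have mf : measurable_fun setT f.
  apply/measurable_EFinP/measurable_funM.
    apply: (measurableT_comp (f := fun s : R => krn x s * expR (- s))) => //.
    exact: measurable_funB.
  by apply: (measurableT_comp (f := fun s : R => krn y s * expR (- s))).
have f0 z : (0 <= f z)%E.
  by rewrite /f lee_fin !mulr_ge0 ?krn_ge0 ?expR_ge0.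
transitivity (\int[mu]_s \int[mu]_w f (s, w))%E.
  transitivity (\int[mu]_s ((krn y s * expR (- s))%:E * eGamma x))%E.
    by rewrite muleC ge0_integralZr//; first [exact: mke|exact: eGamma_ge0|move=> *; exact: ke0].
  apply: eq_integral => s _; rewrite /eGamma.
  rewrite -(ge0_integral_shift (- s))//.
  have mks : measurable_fun setT
      (fun w : R => (krn x (w - s) * expR (- (w - s)))%:E).
    apply/measurable_EFinP.
    apply: (measurableT_comp (f := fun s : R => krn x s * expR (- s))) => //.
    exact: measurable_funB.
  rewrite -(@ge0_integralZl _ _ _ mu _ measurableT _ mks
    (krn y s * expR (- s))%:E (fun w _ => ke0 x (w - s)) (ke0 y s)).
  by apply: eq_integral => w _; rewrite -EFinM mulrC.
rewrite fubini_tonelli// /eGamma -ge0_integralZl//; last exact: krnconv_ge0.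
apply: eq_integral => w _.
rewrite EFinM muleA -krnconvE /krnconv -ge0_integralZr//.
- apply: eq_integral => s _; rewrite -EFinM /f/=; congr EFin.
  have -> : - w = - (w - s) + - s by ring.
  rewrite expRD; ring.
- apply/measurable_EFinP/measurable_funM; [exact: measurable_krnB|].
  exact: measurable_krn.
- by move=> s _; rewrite lee_fin mulr_ge0 ?krn_ge0.
- exact: mke.
Qed.

Lemma measurable_krnM x y t :
  measurable_fun [set: R] (fun s => (krn x (t - s) * krn y s)%:E).
Proof.
apply/measurable_EFinP/measurable_funM; [exact: measurable_krnB|].
exact: measurable_krn.
Qed.

Lemma measurable_eGamma x :
  measurable_fun [set: R] (fun s => (krn x s * expR (- s))%:E).
Proof.
apply/measurable_EFinP/measurable_funM; first exact: measurable_krn.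
exact: measurableT_comp.
Qed.

Lemma integral_powR_itv (x a : R) : 0 < x -> 0 < a < 1 ->
  (\int[mu]_(s in `[a, 1%R]) (s `^ (x - 1))%:E = ((1 - a `^ x) / x)%:E)%E.
Proof.
move=> x0 /andP[a0 a1].
have d (y : R) : 0 < y -> is_derive y 1 (fun s : R => x^-1 * s `^ x) (y `^ (x - 1)).
  move=> y0.
  have := @is_deriveZ _ _ _ _ x^-1 _ _ _ (is_derive1_powR x y0).
  rewrite /GRing.scale/=.
  by rewrite mulrA mulVf ?lt0r_neq0// mul1r.
have cd (y : R) : 0 < y -> {for y, continuous (fun s : R => x^-1 * s `^ x)}.
  by move=> y0; apply/differentiable_continuous/derivable1_diffP; case: (d _ y0).
rewrite (@continuous_FTC2 _ _ (fun s : R => x^-1 * s `^ x))//.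
- by rewrite powR1 -EFinB -mulrBr mulrC.
- apply: continuous_in_subspaceT => y; rewrite inE/= in_itv/= => /andP[ay _].
  have y0 := lt_le_trans a0 ay.
  by apply/differentiable_continuous/derivable1_diffP; case: (is_derive1_powR (x - 1) y0).
- split.
  + by move=> y; rewrite in_itv/= => /andP[ay _]; case: (d _ (lt_trans a0 ay)).
  + by apply/cvg_at_right_filter/cd.
  + exact/cvg_at_left_filter/cd.
- move=> y; rewrite in_itv/= => /andP[ay _].
  by rewrite derive1E; case: (d _ (lt_trans a0 ay)).
Qed.

(** The integrand is singular at 0 when x < 1, hence the exhaustion of ]0, 1] by [1/(n+2), 1] and
    monotone convergence; n + 2 keeps the left end below 1. *)
Lemma krnconv1 x : 0 < x -> krnconv 1 x 1 = (x^-1)%:E.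
Proof.
move=> x0.
pose F (n : nat) : set R := `[n.+2%:R^-1, 1]%classic.
have n2 (n : nat) : 0 < (n.+2%:R : R)^-1 < 1.
  by rewrite invr_gt0 ltr0n/= invf_lt1// ltr1n.
have FU : \bigcup_n F n = `]0, 1]%classic.
  apply/seteqP; split => s /=.
    move=> [n _]; rewrite /F/= !in_itv/= => /andP[ns ->]; rewrite andbT.
    by apply: lt_le_trans ns; case/andP: (n2 n).
  rewrite in_itv/= => /andP[s0 s1].
  exists (Num.truncn s^-1) => //; rewrite /F/= in_itv/= s1 andbT.
  rewrite -[leRHS]invrK lef_pV2 ?posrE ?invr_gt0// ltW//.
  by rewrite (lt_trans (truncnS_gt _))// ltr_nat.
have mp A : measurable_fun A (fun s : R => (s `^ (x - 1))%:E).
  by apply/measurable_EFinP; apply: measurable_funS (measurable_powR _).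
have c1 : (\int[mu]_(s in F n) (s `^ (x - 1))%:E)%E @[n --> \oo] -->
   (\int[mu]_(s in `]0%R, 1%R]) (s `^ (x - 1))%:E)%E.
  rewrite -FU; apply: ge0_nondecreasing_set_cvg_integral => //.
  - move=> m n mn; apply/subsetPset => s; rewrite /F/= !in_itv/=.
    move=> /andP[ms ->]; rewrite andbT (le_trans _ ms)//.
    by rewrite lef_pV2 ?posrE// ler_nat ltnS.
  - by move=> i; exact: measurable_itv.
  - by move=> i; exact: mp.
  - by move=> i s _; rewrite lee_fin powR_ge0.
have c2 : (\int[mu]_(s in F n) (s `^ (x - 1))%:E)%E @[n --> \oo] --> (x^-1)%:E.
  rewrite (_ : (fun n => _) = EFin \o (fun n : nat => (1 - (n.+2%:R^-1) `^ x) / x)).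
    apply/fine_cvgP; split; first exact: nearW.
    rewrite (_ : nbhs (x^-1)%R = nbhs ((1 - 0) * x^-1)%R); last first.
      by rewrite subr0 mul1r.
    rewrite /comp/=; apply: cvgMl; apply: cvgB; first exact: cvg_cst.
    apply: (cvg_comp (fun n : nat => (n.+2%:R : R)^-1) (fun a : R => a `^ x)
      _ (powR_cvg0 x0)) => A /=.
    have : (n.+2%:R^-1 : R) @[n --> \oo] --> (0 : R).
      by have := @cvg_harmonic R; rewrite -(cvg_shiftS (@harmonic R)).
    move=> /(_ _) h [e /= e0 eA].
    have := h (ball 0 e) (nbhsx_ballx _ _ e0).
    apply: (@filterS _ _ _ (fun n : nat => ball (0 : R) e n.+2%:R^-1)) => //.
    by move=> n ne; apply: eA.
  by apply/funext => n; rewrite /F integral_powR_itv.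
rewrite -(cvg_unique _ c1 c2)// -integral_itv_bndo_bndc// integral_mkcond/=.
apply: eq_integral => s _; rewrite patchE mem_setE in_itv/= /krn subr_gt0.
case: (ltP 0 s) => s0; last by rewrite mulr0.
by case: ifP => s1; rewrite ?mul0r// subrr powRr0 mul1r.
Qed.

Lemma eGamma1 : eGamma 1 = 1%E.
Proof.
rewrite -(@integral_exponential_pdf R 1)// /eGamma.
transitivity (\int[mu]_(s in `[0%R, +oo[) (expR (- s))%:E)%E; last first.
  rewrite integral_mkcond; apply: eq_integral => s _.
  by rewrite /exponential_pdf !patchE; case: ifP; rewrite ?mul1r ?mulN1r.
rewrite -integral_itv_obnd_cbnd; last first.
  by apply/measurable_EFinP; apply: measurableT_comp.
rewrite [RHS]integral_mkcond.
apply: eq_integral => s _; rewrite patchE mem_setE in_itv/= /krn andbT.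
by case: ifP; rewrite ?mul0r// subrr powRr0 mul1r.
Qed.

(** On ]0, 1[ the exponential is at least [expR (-1)], and the power alone integrates to 1/x. *)
Lemma eGamma_gt0 x : 0 < x -> (0 < eGamma x)%E.
Proof.
move=> x0; have xi : (0 < (expR (-1) * x^-1)%:E :> \bar R)%E.
  by rewrite lte_fin mulr_gt0 ?expR_gt0 ?invr_gt0.
apply: lt_le_trans xi _; rewrite EFinM -krnconv1// /krnconv -ge0_integralZl//=.
- apply: ge0_le_integral => //.
  + by move=> s _; rewrite lee_fin !mulr_ge0 ?krn_ge0 ?expR_ge0.
  + by apply: measurable_funeM; exact: measurable_krnM.
  + exact: measurable_eGamma.
  + move=> s _; rewrite -EFinM lee_fin mulrA mulrC ler_wpM2l ?krn_ge0//.
    rewrite /krn subr_gt0; case: ifP => s1; last by rewrite mulr0 expR_ge0.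
    by rewrite subrr powRr0 mulr1 ler_expR lerN2 ltW.
- exact: measurable_krnM.
- by move=> s _; rewrite lee_fin mulr_ge0 ?krn_ge0.
Qed.

(* For [x <= 1] by direct comparison; then [eGamma_Beta] with both arguments
   [x / 2] carries finiteness from [x / 2] to [x]. *)
Lemma eGamma_lt_pinfty x : 0 < x -> (eGamma x < +oo)%E.
Proof.
have h (n : nat) : forall y, 0 < y <= 2 ^+ n -> (eGamma y < +oo)%E.
  elim: n => [y /andP[y0 +]|n ih y /andP[y0 y1]].
    rewrite expr0 => y1.
    apply: (@le_lt_trans _ _ (krnconv 1 y 1 + eGamma 1)%E); last first.
      by rewrite krnconv1// eGamma1 -EFinD ltry.
    rewrite /krnconv /eGamma -ge0_integralD//.
    - apply: ge0_le_integral => //.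
      + by move=> s _; rewrite lee_fin mulr_ge0 ?krn_ge0 ?expR_ge0.
      + exact: measurable_eGamma.
      + by apply: emeasurable_funD; [exact: measurable_krnM|exact: measurable_eGamma].
      + move=> s _; rewrite -EFinD lee_fin /krn subr_gt0.
        case: (ltP 0 s) => s0; last by rewrite !mul0r mulr0 addr0.
        rewrite subrr !powRr0 mul1r; case: (ltP s 1) => s1.
          rewrite mul1r (@le_trans _ _ (s `^ (y - 1)))//; last by rewrite lerDl expR_ge0.
          by rewrite ler_piMr ?powR_ge0// expR_le1 oppr_le0 ltW.
        rewrite mul0r add0r ler_piMl ?expR_ge0//.
        by rewrite -[leRHS](powRr0 s) ler_powR// subr_le0.
    - by move=> s _; rewrite lee_fin mulr_ge0 ?krn_ge0.
    - exact: measurable_krnM.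
    - by move=> s _; rewrite lee_fin mulr_ge0 ?krn_ge0 ?expR_ge0.
    - exact: measurable_eGamma.
  have y20 : 0 < y / 2 by rewrite divr_gt0.
  have y2 : 0 < y / 2 <= 2 ^+ n by rewrite y20 ler_pdivrMr// -exprSr.
  have := eGamma_Beta (y / 2) (y / 2); rewrite -splitr => e.
  rewrite ltNge leye_eq; apply/negP => /eqP yy.
  have g0 := eGamma_gt0 y20; have gy := ih _ y2.
  (* The Beta factor cannot vanish, or [eGamma (y / 2)] would; so an infinite [eGamma y] would
     equate an infinite product with a finite one. *)
  have b0 : (0 < krnconv (y / 2) (y / 2) 1)%E.
    rewrite lt_neqAle krnconv_ge0 andbT eq_sym; apply/eqP => b0.
    move: e; rewrite b0 mul0e => /eqP; rewrite mule_eq0 orbb => /eqP g00.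
    by rewrite g00 ltxx in g0.
  move: e; rewrite yy gt0_muley// => e.
  have gf : eGamma (y / 2) \is a fin_num by rewrite ge0_fin_numE// ltW.
  by move/(congr1 (fun z => z \is a fin_num)): e; rewrite fin_numM.
move=> x0; apply: (h (Num.truncn x).+1); rewrite x0/=.
apply: le_trans (ltW (truncnS_gt x)) _; rewrite -natrX ler_nat.
exact/ltnW/ltn_expl.
Qed.

End Kernel.

Section GammaTheory.
Context {R : realType}.
Local Notation mu := (@lebesgue_measure R).

Lemma eGammaE (x : R) : 0 < x -> eGamma x = (Gamma x)%:E.
Proof.
move=> x0.
have -> : Gamma x = fine (eGamma x).
  rewrite /Gamma /Rintegral integral_mkcond/= /eGamma; congr fine.
  apply: eq_integral => s _; rewrite patchE /krn.
  by rewrite mem_setE/= in_itv/= andbT; case: ifP; rewrite ?mul0r.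
by rewrite fineK// ge0_fin_numE ?ltW ?eGamma_gt0// eGamma_lt_pinfty.
Qed.

Lemma Gamma_gt0 (x : R) : 0 < x -> 0 < Gamma x.
Proof. by move=> x0; rewrite -lte_fin -eGammaE// eGamma_gt0. Qed.

Lemma Gamma_neq0 (x : R) : 0 < x -> Gamma x != 0.
Proof. by move=> /Gamma_gt0; exact: lt0r_neq0. Qed.

Lemma Gamma1 : Gamma 1 = 1 :> R.
Proof. by apply/EFin_inj; rewrite -eGammaE// eGamma1. Qed.

Lemma krnconv_Gamma (x y : R) : 0 < x -> 0 < y ->
  krnconv x y 1 = (Gamma x * Gamma y / Gamma (x + y))%:E.
Proof.
move=> x0 y0; have xy0 : 0 < x + y by rewrite addr_gt0.
have := eGamma_Beta x y; rewrite !eGammaE//.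
have := krnconv_ge0 x y 1; case: (krnconv x y 1) => [b _|_|//].
  rewrite -!EFinM => -[->]; congr EFin; rewrite mulfK//.
  exact/lt0r_neq0/Gamma_gt0.
by rewrite gt0_mulye// lte_fin Gamma_gt0.
Qed.

(** The Beta integral with first argument 1 has the two values 1/x and Gamma x / Gamma (1 + x),
    which replaces integration by parts. *)
Lemma GammaS (x : R) : 0 < x -> Gamma (x + 1) = x * Gamma x.
Proof.
move=> x0; have := krnconv_Gamma ltr01 x0; rewrite krnconv1// Gamma1 mul1r => -[].
rewrite addrC => e; have := Gamma_gt0 (addr_gt0 x0 ltr01).
move: e; set g := Gamma (x + 1) => e g0.
have g1 : g != 0 by exact: lt0r_neq0.
have x1 : x != 0 by exact: lt0r_neq0.
have -> : Gamma x = x^-1 * g by rewrite e; field.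
by field.
Qed.

End GammaTheory.

(** * Riemann-Liouville integrals *)

Section Semigroup.
Context {R : realType}.
Local Notation mu := (@lebesgue_measure R).
Implicit Types (g : R -> R) (x y s t r : R).

Lemma measurable_powR_subl (D : set R) x t :
  measurable_fun D (fun s : R => (t - s) `^ x).
Proof.
apply: measurable_funTS.
apply: (measurableT_comp (measurable_powR x)).
exact: measurable_funB.
Qed.

(** The cut-off of [g] is at the fixed [t], not at [s]: a single function on the line then serves
    all s <= t, as convolution requires. *)
Lemma integral_RL_krn g x s t : s <= t -> measurable_fun `[0, t] g ->
  (\int[mu]_(r in `[0%R, s]) ((s - r) `^ (x - 1) * g r)%:E =
   \int[mu]_r (krn x (s - r) * (g \_ `[0, t]) r)%:E)%E.
Proof.
move=> st mg.
have mgs : measurable_fun `[0, s[ g.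
  apply: measurable_funS mg => // r /=; rewrite !in_itv/= => /andP[-> rs] /=.
  by rewrite (le_trans (ltW rs)).
rewrite -integral_itv_bndo_bndc; last first.
  by apply/measurable_EFinP/measurable_funM => //; exact: measurable_powR_subl.
rewrite integral_mkcond; apply: eq_integral => r _.
rewrite !patchE !mem_setE !in_itv/= /krn subr_gt0.
case: (ltP r s) => rs; last by rewrite andbF mul0r.
rewrite andbT (le_trans (ltW rs) st) andbT.
by case: ifP => _; rewrite ?mulr0.
Qed.

Lemma measurable_conv_krn x (h : R -> R) : measurable_fun setT h ->
  (forall r, 0 <= h r) ->
  measurable_fun [set: R] (fun s => \int[mu]_r (krn x (s - r) * h r)%:E)%E.
Proof.
move=> mh h0.
apply: (@measurable_fun_fubini_tonelli_F _ _ _ _ R mu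
  (fun z : R * R => (krn x (z.1 - z.2) * h z.2)%:E)).
- apply/measurable_EFinP/measurable_funM; last exact: measurableT_comp.
  by apply: measurableT_comp; [exact: measurable_krn|exact: measurable_funB].
- by move=> z; rewrite lee_fin mulr_ge0 ?krn_ge0.
Qed.

(** After Tonelli the inner integral is, up to a shift by r, [krnconv x y (t - r)], hence a multiple
    of [krn (x + y) (t - r)]. *)
Lemma conv_krn_conv x y (h : R -> R) t : measurable_fun setT h ->
  (forall r, 0 <= h r) ->
  (\int[mu]_s ((krn x (t - s))%:E * \int[mu]_r (krn y (s - r) * h r)%:E) =
   krnconv x y 1 * \int[mu]_r (krn (x + y) (t - r) * h r)%:E)%E.
Proof.
move=> mh h0.
pose f (z : R * R) := (krn x (t - z.1) * (krn y (z.1 - z.2) * h z.2))%:E.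
have mf : measurable_fun setT f.
  apply/measurable_EFinP/measurable_funM.
    by apply: measurableT_comp; [exact: measurable_krn|exact: measurable_funB].
  apply: measurable_funM; last exact: measurableT_comp.
  by apply: measurableT_comp; [exact: measurable_krn|exact: measurable_funB].
have f0 z : (0 <= f z)%E by rewrite lee_fin !mulr_ge0 ?krn_ge0.
transitivity (\int[mu]_s \int[mu]_r f (s, r))%E.
  apply: eq_integral => s _.
  have mk : measurable_fun setT (fun r : R => (krn y (s - r) * h r)%:E).
    by apply/measurable_EFinP/measurable_funM => //; exact: measurable_krnB.
  rewrite -(ge0_integralZl mu measurableT mk)//.
  - by move=> r _; rewrite lee_fin mulr_ge0 ?krn_ge0.
  - by rewrite lee_fin krn_ge0.
rewrite fubini_tonelli//.
have mk : measurable_fun setT (fun r : R => (krn (x + y) (t - r) * h r)%:E).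
  by apply/measurable_EFinP/measurable_funM => //; exact: measurable_krnB.
rewrite -(ge0_integralZl mu measurableT mk)//; last 2 first.
- by move=> r _; rewrite lee_fin mulr_ge0 ?krn_ge0.
- exact: krnconv_ge0.
apply: eq_integral => r _.
rewrite EFinM muleA -krnconvE /krnconv.
have mk2 := measurable_krnM x y (t - r).
rewrite -(ge0_integralZr mu measurableT mk2)//; last 2 first.
- by move=> s _; rewrite lee_fin mulr_ge0 ?krn_ge0.
- by rewrite lee_fin.
pose k s := (krn x (t - r - s) * krn y s * h r)%:E.
have mk3 : measurable_fun setT k.
  apply/measurable_EFinP; apply: measurable_funM => //.
  exact/measurable_EFinP.
transitivity (\int[mu]_s k (s + - (r : R))%R)%E.
  apply: eq_integral => s _; rewrite /k /f/= mulrA; congr (krn _ _ * _ * _)%:E.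
  by ring.
rewrite ge0_integral_shift//; last first.
  by move=> s; rewrite lee_fin !mulr_ge0 ?krn_ge0.
Qed.

Lemma ge0_RLint_existsP g x t : measurable_fun `[0, t] g ->
  (forall s, 0 <= s <= t -> 0 <= g s) ->
  RLint_exists x g t <->
  (\int[mu]_(s in `[0%R, t]) ((t - s) `^ (x - 1) * g s)%:E < +oo)%E.
Proof.
move=> mg g0; rewrite /RLint_exists.
have mk : measurable_fun `[0, t] (fun s => ((t - s) `^ (x - 1) * g s)%:E).
  apply/measurable_EFinP/measurable_funM => //; exact: measurable_powR_subl.
have e : (\int[mu]_(s in `[0%R, t]) `|((t - s) `^ (x - 1) * g s)%:E| =
    \int[mu]_(s in `[0%R, t]) ((t - s) `^ (x - 1) * g s)%:E)%E.
  apply: eq_integral => s; rewrite inE/= in_itv/= => /g0 gs.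
  by rewrite /= ger0_norm// mulr_ge0 ?powR_ge0.
split => [/integrableP[_]|h]; first by rewrite e.
by apply/integrableP; split=> //; rewrite e.
Qed.

Lemma RLint_ge0 g x t : 0 < x -> (forall s, 0 <= s <= t -> 0 <= g s) ->
  0 <= RLint x g t.
Proof.
move=> x0 g0; rewrite /RLint mulr_ge0 ?invr_ge0 ?(ltW (Gamma_gt0 _))//.
by apply: Rintegral_ge0 => s; rewrite /= in_itv/= => /g0 ?; rewrite mulr_ge0 ?powR_ge0.
Qed.

Lemma EFin_RLint g x t : RLint_exists x g t ->
  ((RLint x g t)%:E = (Gamma x)^-1%:E *
    \int[mu]_(s in `[0%R, t]) ((t - s) `^ (x - 1) * g s)%:E)%E.
Proof.
move=> e; rewrite /RLint EFinM /Rintegral fineK//.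
exact: integrable_fin_num.
Qed.

(** The identity is between extended reals and holds before the order x + y integral is known to be
    finite; existence and value of the iterated integral are both read off it. *)
Lemma integral_RLint_RLint g x y t : 0 < x -> 0 < y ->
  measurable_fun `[0, t] g ->
  (forall s, 0 <= s <= t -> 0 <= g s) ->
  (forall s, 0 <= s <= t -> RLint_exists y g s) ->
  measurable_fun `[0, t] (RLint y g) /\
  (\int[mu]_(s in `[0%R, t]) ((t - s) `^ (x - 1) * RLint y g s)%:E =
   (Gamma x / Gamma (x + y))%:E *
   \int[mu]_(s in `[0%R, t]) ((t - s) `^ (x + y - 1) * g s)%:E)%E.
Proof.
move=> x0 y0 mg g0 ge.
pose h := g \_ `[0, t].
have mh : measurable_fun setT h by apply/(measurable_restrictT _ _).1.
have h0 r : 0 <= h r.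
  by rewrite /h patchE; case: ifP => //; rewrite inE/= in_itv/= => /g0.
pose Phi s := (\int[mu]_r (krn y (s - r) * h r)%:E)%E.
have mPhi : measurable_fun setT Phi by exact: measurable_conv_krn.
have Phi0 s : (0 <= Phi s)%E.
  by apply: integral_ge0 => r _; rewrite lee_fin mulr_ge0 ?krn_ge0.
have RLE s : 0 <= s <= t -> ((RLint y g s)%:E = (Gamma y)^-1%:E * Phi s)%E.
  move=> st; rewrite EFin_RLint; last exact: ge.
  congr (_ * _)%E; by apply: integral_RL_krn => //; case/andP: st.
have mRL : measurable_fun `[0, t] (RLint y g).
  apply/measurable_EFinP; apply: (@eq_measurable_fun _ _ _ _ _
    (fun s => (Gamma y)^-1%:E * Phi s)%E).
    by move=> s; rewrite inE/= in_itv/= => /RLE.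
  by apply: measurable_funTS; exact: measurable_funeM.
split => //.
rewrite (@integral_RL_krn _ _ _ t)//.
transitivity (\int[mu]_s ((Gamma y)^-1%:E * ((krn x (t - s))%:E * Phi s)))%E.
  apply: eq_integral => s _; rewrite patchE; case: ifP.
    by rewrite inE/= in_itv/= => /RLE e; rewrite EFinM e muleCA.
  (* Outside [0, t] the convolution form must vanish too: beyond t the outer kernel does, and for s
     < 0 the inner integral only sees negative r, where [h] is 0. *)
  rewrite mulr0 mem_setE/= in_itv/= => /negP.
  case: (leP s t) => st; last first.
    by rewrite /krn subr_gt0 ltNge (ltW st)/= mul0e mule0.
  rewrite andbT => /negP; rewrite -ltNge => s0.
  rewrite (_ : Phi s = 0%E) ?mule0//; apply: integral0_eq => r _.
  rewrite /krn subr_gt0; case: ltP => rs; last by rewrite mul0r.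
  rewrite /h patchE mem_setE in_itv/= leNgt (lt_trans rs s0)/=.
  by rewrite mulr0.
rewrite ge0_integralZl//; last 3 first.
- apply: emeasurable_funM => //; apply/measurable_EFinP; exact: measurable_krnB.
- by move=> s _; rewrite mule_ge0// lee_fin krn_ge0.
- by rewrite lee_fin invr_ge0 ltW// Gamma_gt0.
rewrite conv_krn_conv// krnconv_Gamma// muleA -EFinM.
rewrite (@integral_RL_krn _ _ _ t)//; congr (_%:E * _)%E.
have := Gamma_neq0 y0; have := Gamma_neq0 (addr_gt0 x0 y0).
by move: (Gamma x) (Gamma y) (Gamma (x + y)) => a b c c0 b0; field; rewrite c0 b0.
Qed.

Lemma RLint_RLint_exists g x y t : 0 < x -> 0 < y ->
  measurable_fun `[0, t] g ->
  (forall s, 0 <= s <= t -> 0 <= g s) ->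
  (forall s, 0 <= s <= t -> RLint_exists y g s) ->
  RLint_exists (x + y) g t -> RLint_exists x (RLint y g) t.
Proof.
move=> x0 y0 mg g0 ge gxy.
have [mR e] := integral_RLint_RLint x0 y0 mg g0 ge.
apply/ge0_RLint_existsP => //.
  move=> s /andP[s0 st]; apply: RLint_ge0 => // r /andP[r0 rs].
  by apply: g0; rewrite r0 (le_trans rs).
rewrite e; move/ge0_RLint_existsP : gxy => /(_ mg g0) gxy.
rewrite lte_mul_pinfty//.
by rewrite lee_fin divr_ge0// ltW// Gamma_gt0// addr_gt0.
Qed.

Lemma RLint_RLint g x y t : 0 < x -> 0 < y ->
  measurable_fun `[0, t] g ->
  (forall s, 0 <= s <= t -> 0 <= g s) ->
  (forall s, 0 <= s <= t -> RLint_exists y g s) ->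
  RLint_exists (x + y) g t -> RLint x (RLint y g) t = RLint (x + y) g t.
Proof.
move=> x0 y0 mg g0 ge gxy.
have [mR e] := integral_RLint_RLint x0 y0 mg g0 ge.
apply: EFin_inj; rewrite EFin_RLint; last exact: RLint_RLint_exists.
rewrite e (EFin_RLint gxy) [LHS]muleA; congr (_ * _)%E.
rewrite -EFinM; congr EFin.
have := Gamma_neq0 x0; have := Gamma_neq0 (addr_gt0 x0 y0).
by move: (Gamma x) (Gamma (x + y)) => a c c0 a0; field; rewrite a0 c0.
Qed.

Lemma integral_RL_powR x y t : 0 < t ->
  (\int[mu]_(s in `[0%R, t]) ((t - s) `^ (x - 1) * s `^ (y - 1))%:E =
   krnconv x y t)%E.
Proof.
move=> t0.
have mp : measurable_fun setT (fun s : R => ((t - s) `^ (x - 1) * s `^ (y - 1))%:E).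
  apply/measurable_EFinP/measurable_funM; last exact: measurable_powR.
  exact: measurable_powR_subl.
rewrite -integral_itv_bndo_bndc; last exact: measurable_funTS.
rewrite -integral_itv_obnd_cbnd; last exact: measurable_funTS.
rewrite integral_mkcond; apply: eq_integral => s _.
rewrite patchE mem_setE in_itv/= /krn subr_gt0.
by case: ltP => s0; case: ltP => st; rewrite ?mulr0 ?mul0r.
Qed.

Lemma RLint_powR_exists x y t : 0 < x -> 0 < y -> 0 <= t ->
  RLint_exists x (fun s => s `^ (y - 1)) t.
Proof.
move=> x0 y0; rewrite le_eqVlt => /predU1P[<-|t0].
  rewrite /RLint_exists set_itv1; apply/integrableP; split.
    exact: measurable_fun_set1.
  by rewrite integral_set1.
apply/ge0_RLint_existsP.
- by apply: measurable_funTS; exact: measurable_powR.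
- by move=> s _; rewrite powR_ge0.
by rewrite integral_RL_powR// krnconvE krnconv_Gamma// -EFinM ltry.
Qed.

(** The bound on x + y takes care of t = 0, where the integral is 0 while [powR] with exponent 0 is
    1. *)
Lemma RLint_powR x y t : 0 < x -> 0 < y -> 1 < x + y -> 0 <= t ->
  RLint x (fun s => s `^ (y - 1)) t =
  Gamma y / Gamma (x + y) * t `^ (x + y - 1).
Proof.
move=> x0 y0 xy; rewrite le_eqVlt => /predU1P[<-|t0].
  rewrite /RLint set_itv1 Rintegral_set1 mulr0 powR0 ?mulr0//.
  by rewrite subr_eq0 gt_eqF.
rewrite /RLint /Rintegral integral_RL_powR// krnconvE krnconv_Gamma// -EFinM/=.
rewrite /krn t0.
have := Gamma_neq0 x0; have := Gamma_neq0 (addr_gt0 x0 y0).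
move: (Gamma x) (Gamma y) (Gamma (x + y)) (_ `^ _) => a b c d c0 a0.
by field; rewrite c0 a0.
Qed.

End Semigroup.

(** * Calculus on the half line *)

Lemma near_withinW (T : Type) (F : set_system T) (D P : set T) : Filter F ->
  (forall x, D x -> P x) -> within D F P.
Proof. by move=> FF DP; apply: filterS (withinT D FF). Qed.

Section HalfLineCalculus.
Context {R : realType}.
Local Notation mu := (@lebesgue_measure R).
Implicit Types (g : R -> R) (x y s t l : R).

Definition is_hderive g t l : Prop :=
  hquot g t h @[h --> within [set h : R | 0 <= h + t] 0^'] --> l.

Definition hcont g t : Prop :=
  g s @[s --> within [set s : R | 0 <= s] (nbhs t)] --> g t.

Lemma within_dnbhs_proper t : 0 <= t ->
  ProperFilter (within [set h : R | 0 <= h + t] (0 : R)^').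
Proof.
move=> t0; split; last exact: within_filter.
rewrite /within/= => A0.
have [e /= e0 eA] : \forall h \near (0 : R)^', 0 <= h + t -> False := A0.
apply: (eA (e / 2)) => /=.
- by rewrite sub0r normrN gtr0_norm ?divr_gt0// ltr_pdivrMr// ltr_pMr// ltr1n.
- by rewrite gt_eqF// divr_gt0.
- by rewrite addr_ge0// ltW// divr_gt0.
Qed.

Lemma is_hderiveP g t l : 0 <= t -> is_hderive g t l ->
  hderivable g t /\ hderive g t = l.
Proof.
move=> t0 gl; have := within_dnbhs_proper t0 => FF; split.
  by apply/cvg_ex; exists l.
by apply/cvg_lim => //; exact: Rhausdorff.
Qed.

Lemma eq_is_hderive g1 g2 t l : 0 <= t -> (forall s, 0 <= s -> g1 s = g2 s) ->
  is_hderive g1 t l -> is_hderive g2 t l.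
Proof.
move=> t0 g12; apply: cvg_trans; apply: near_eq_cvg.
by apply: near_withinW => h /= h0; rewrite /hquot !g12.
Qed.

Lemma eq_hcont g1 g2 t : 0 <= t -> (forall s, 0 <= s -> g1 s = g2 s) ->
  hcont g1 t -> hcont g2 t.
Proof.
move=> t0 g12; rewrite /hcont g12//; apply: cvg_trans; apply: near_eq_cvg.
by apply: near_withinW => h /= h0; rewrite g12.
Qed.

Lemma eq_hderive g1 g2 t : 0 <= t -> (forall s, 0 <= s -> g1 s = g2 s) ->
  (hderivable g1 t -> hderivable g2 t) /\ hderive g1 t = hderive g2 t.
Proof.
move=> t0 g12.
have h12 h : 0 <= h + t -> hquot g1 t h = hquot g2 t h.
  by move=> h0; rewrite /hquot !g12.
have e : hquot g1 t h @[h --> within [set h : R | 0 <= h + t] 0^'] =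
         hquot g2 t h @[h --> within [set h : R | 0 <= h + t] 0^'].
  apply/seteqP; split => A /=; rewrite /nbhs/= /within/=; apply: filterS => h.
    by move=> + h0 => /(_ h0); rewrite h12.
  by move=> + h0 => /(_ h0); rewrite h12.
by rewrite /hderivable /hderive e.
Qed.

Lemma is_hderiveD_cst g t l (c : R) :
  is_hderive g t l -> is_hderive (fun s => c + g s) t l.
Proof.
rewrite /is_hderive (_ : hquot (fun s => c + g s) t = hquot g t)//.
by apply/funext => h; rewrite /hquot; congr (_ *: _); ring.
Qed.

Lemma is_hderiveZ g t l (c : R) :
  is_hderive g t l -> is_hderive (fun s => c * g s) t (c * l).
Proof.
move=> gl; rewrite /is_hderive.
rewrite (_ : hquot _ t = fun h => c * hquot g t h).
  by apply: cvgMr; exact: gl.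
by apply/funext => h; rewrite /hquot /GRing.scale/=; ring.
Qed.

Lemma continuous_hcont g t : {for t, continuous g} -> hcont g t.
Proof. by move=> ct; exact: cvg_within_filter. Qed.

Lemma hcont_within g x : (forall t, 0 <= t -> hcont g t) ->
  {within `[0, x], continuous g}.
Proof.
move=> cg; apply/subspace_continuousP => t /=.
rewrite in_itv/= => /andP[t0 tx].
apply: cvg_trans (cg _ t0); apply: cvg_app; apply: within_subset => s /=.
by rewrite in_itv/= => /andP[].
Qed.

Lemma hcont_integrable g x : (forall t, 0 <= t -> hcont g t) ->
  mu.-integrable `[0, x] (EFin \o g).
Proof.
move=> cg; apply: continuous_compact_integrable; first exact: segment_compact.
exact: hcont_within.
Qed.

Lemma is_hderive_derivable g t l : 0 < t -> derivable g t 1 -> derive1 g t = l ->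
  is_hderive g t l.
Proof.
move=> t0 dg <-; have h := (hderivableE g t0).2 dg.
by rewrite /is_hderive -hderiveE//; exact: h.
Qed.

(** For t > 0 this is the two-sided theorem on [0, t + 1]; only the right derivative at 0 needs a
    separate estimate of the mean of [g] over [0, h]. *)
Lemma FTC_half_line g t : 0 <= t -> (forall x, mu.-integrable `[0, x] (EFin \o g)) ->
  hcont g t -> is_hderive (fun y => \int[mu]_(s in `[0, y]) g s) t (g t).
Proof.
rewrite le_eqVlt => /predU1P[<-|t0] ig cg.
  apply/cvgrPdist_le => e e0.
  have /cvgrPdist_le /(_ e e0) cge := cg.
  have [d /= d0 dg] : \forall s \near (0 : R), 0 <= s -> `|g 0 - g s| <= e := cge.
  exists d => // h /=; rewrite sub0r normrN => hd h0; rewrite addr0 => hge0.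
  have hgt0 : 0 < h by rewrite lt_neqAle eq_sym h0.
  rewrite /hquot addr0 set_itv1 Rintegral_set1 subr0 /GRing.scale/=.
  have ic : mu.-integrable `[0, h] (EFin \o cst (g 0)).
    apply: continuous_compact_integrable; first exact: segment_compact.
    by apply: continuous_subspaceT => x; exact: cst_continuous.
  have -> : g 0 = h^-1 * \int[mu]_(s in `[0, h]) (g 0).
    rewrite Rintegral_cst//= lebesgue_measure_itv/= lte_fin hgt0 -EFinB/= subr0.
    by field.
  have id : mu.-integrable `[0, h] (EFin \o (fun s => g 0 - g s)).
    by apply: integrableB ic (ig h).
  rewrite -mulrBr -RintegralB// normrM normfV (gtr0_norm hgt0).
  rewrite ler_pdivrMl//; apply: le_trans.
    exact: (le_normr_Rintegral _ id).
  have -> : h * e = \int[mu]_(s in `[0, h]) e.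
    rewrite Rintegral_cst//= lebesgue_measure_itv/= lte_fin hgt0 -EFinB/= subr0.
    by rewrite mulrC.
  apply: le_Rintegral => //.
  - exact: integrable_norm.
  - apply: continuous_compact_integrable; first exact: segment_compact.
    by apply: continuous_subspaceT => x; exact: cst_continuous.
  - move=> s /=; rewrite in_itv/= => /andP[s0 sh]; apply: dg => //=.
    by rewrite sub0r normrN ger0_norm// (le_lt_trans sh)// -(gtr0_norm hgt0).
have t1 : t < t + 1 by rewrite ltrDl.
have ct : {for t, continuous g}.
  move: cg; rewrite /hcont => cg A /cg.
  rewrite /within/= /nbhs/= => wA.
  have : \forall s \near t, 0 < s by exact: lt_nbhsr.
  by apply: filterS2 wA => s As /ltW /As.
have [d1 d2] := continuous_FTC1_closed t1 (ig _) t0 ct.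
exact: is_hderive_derivable.
Qed.

Lemma hcont_integral g t : 0 <= t -> (forall x, mu.-integrable `[0, x] (EFin \o g)) ->
  hcont (fun y => \int[mu]_(s in `[0, y]) g s) t.
Proof.
move=> t0 ig.
have t1 : 0 <= t + 1 by rewrite addr_ge0.
have /subspace_continuousP := parameterized_integral_continuous t1 (ig _).
move=> /(_ t); rewrite /= in_itv/= t0 lerDl ler01 => /(_ isT).
move=> c A /c; rewrite /within/= /nbhs/= => wA.
have : \forall s \near t, s < t + 1 by apply: lt_nbhsl; rewrite ltrDl.
apply: filterS2 wA => s As st s0; apply: As.
by rewrite in_itv/= s0 ltW.
Qed.

(** Lebesgue differentiation, for weights that are not continuous. Extension by 0 makes [g] locally
    integrable on the line, and the point 0 is discarded as a null set. *)
Lemma ae_FTC_half_line g : (forall x, mu.-integrable `[0, x] (EFin \o g)) ->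
  {ae mu, forall t : R, 0 <= t ->
     is_hderive (fun y => \int[mu]_(s in `[0, y]) g s) t (g t)}.
Proof.
move=> ig; pose f := g \_ `[0, +oo[.
have fE x : {in `[0, x]%classic, f =1 g}.
  move=> s; rewrite inE/= in_itv/= => /andP[s0 _].
  by rewrite /f patchE mem_setE in_itv/= s0.
have iff x : mu.-integrable `[0, x] (EFin \o f).
  by apply: eq_integrable (ig x) => // s sx /=; rewrite (fE x).
have locf : locally_integrable [set: R] f.
  have mf : measurable_fun setT f.
    have mn (n : nat) : measurable_fun `[0, n%:R : R] g.
      by have /measurable_int/measurable_EFinP := ig n%:R.
    apply/(measurable_restrictT _ _).1; first exact: measurable_itv.
    rewrite itv_bndy_bigcup_BRight/=.
    apply/measurable_fun_bigcup => n; first exact: measurable_itv.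
    by rewrite add0r.
  split; [exact: mf|exact: openT|move=> K _ cK].
  have [M [_ MK]] := compact_bounded cK.
  pose b := `|M| + 1.
  have Kb : K `<=` `]-oo, b]%classic.
    move=> s Ks /=; rewrite in_itv/=; apply: le_trans (ler_norm s) _; apply: MK => //.
    by rewrite (le_lt_trans (ler_norm M))// ltrDl.
  have mK : measurable K by exact: closed_measurable (compact_closed _ cK).
  apply: le_lt_trans (ge0_subset_integral mu mK _ _ _ Kb) _ => //.
    by apply/measurable_EFinP; apply: measurableT_comp => //; exact: measurable_funTS.
  have /integrableP[_] := iff b; congr (_ < _)%E.
  rewrite [LHS]integral_mkcond [RHS]integral_mkcond; apply: eq_integral => s _.
  rewrite !patchE !mem_setE !in_itv/=; case: leP => s0 /=; first by [].
  by case: ifP => // _; rewrite /f patchE mem_setE in_itv/= leNgt s0 normr0.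
have F1 := @FTC1 R f (BLeft 0) iff locf.
have F2 : {ae mu, forall t : R, t != 0}.
  exists [set 0]; split; [exact: measurable_set1|exact: lebesgue_measure_set1|].
  by move=> s /= /negP; rewrite negbK => /eqP.
have FF : Filter (almost_everywhere mu) := ae_filter_ringOfSetsType mu.
apply: filterS2 F1 F2 => t /= F1 t0 tge0.
have tgt0 : 0 < t by rewrite lt_neqAle eq_sym t0.
apply: (@eq_is_hderive (fun y => \int[mu]_(s in `[0, y]) f s)) => //.
  by move=> s s0; apply: eq_Rintegral => r; exact: fE.
have [|d1 d2] := F1; first by rewrite lte_fin.
apply: is_hderive_derivable => //.
by rewrite d2 (fE t)// inE/= in_itv/= lexx tge0.
Qed.

(** Differentiation descends a chain of primitives. Its last step, from [G 1], is required at the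
    point [t] alone, because the final derivative may exist only almost everywhere. *)
Lemma hnderive_chain (G : nat -> R -> R) t l : 0 <= t ->
  (forall k s, 0 <= s -> is_hderive (G k.+2) s (G k.+1 s)) ->
  is_hderive (G 1%N) t l ->
  forall n g, (0 < n)%N -> (forall s, 0 <= s -> g s = G n s) ->
  hnderivable n g t /\ iter n hderive g t = l.
Proof.
move=> t0 GS G1 [//|n] g _ gG.
have key j : forall k, (j + k = n)%N -> forall s, 0 <= s ->
    hnderivable j g s /\ iter j hderive g s = G k.+1 s.
  elim: j => [k kn s s0|j ih k jk s s0]; first by rewrite /= gG// -kn.
  have [d1 d2] := is_hderiveP s0 (GS k s s0).
  have e r : 0 <= r -> G k.+2 r = iter j hderive g r.
    by move=> r0; have [_ ->] := ih k.+1 (etrans (addnS _ _) jk) r r0.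
  have [e1 e2] := eq_hderive s0 e.
  split; last by rewrite iterS -e2.
  split; last exact: e1.
  apply: near_withinW => r /= r0.
  by have [] := ih k.+1 (etrans (addnS _ _) jk) r r0.
have [d1 d2] := is_hderiveP t0 G1.
have e r : 0 <= r -> G 1%N r = iter n hderive g r.
  by move=> r0; have [_ ->] := key n 0%N (addn0 _) r r0.
have [e1 e2] := eq_hderive t0 e.
split; last by rewrite iterS -e2.
split; last exact: e1.
apply: near_withinW => r /= r0.
by have [] := key n 0%N (addn0 _) r r0.
Qed.

End HalfLineCalculus.

(** * Continuity of fractional integrals and compactness *)

Section RealAnalysis.
Context {R : realType}.
Local Notation mu := (@lebesgue_measure R).
Implicit Types (x s t : R).

Lemma continuous_within_comp (X Y Z : topologicalType) (D : set X) (f : X -> Y)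
    (phi : Z -> X) : {within D, continuous f} -> continuous phi ->
  (forall z, D (phi z)) -> continuous (f \o phi).
Proof.
move=> /subspace_continuousP cf cphi Dphi z.
apply: (@cvg_comp _ _ _ phi f _ (within D (nbhs (phi z)))); last exact: cf.
move=> A; rewrite /within/= => wA.
apply: (@filterS _ (nbhs z) _ (phi @^-1` (fun y => D y -> A y))).
  by move=> y /= /(_ (Dphi y)).
exact: cphi.
Qed.

Lemma ae_neq x : {ae mu, forall s : R, s != x}.
Proof.
exists [set x]; split; [exact: measurable_set1|exact: lebesgue_measure_set1|].
by move=> s /= /negP; rewrite negbK => /eqP.
Qed.

Lemma krn_continuous_neq0 x t : t != 0 -> {for t, continuous (krn x)}.
Proof.
move=> tn0; have /orP[t0|t0] : (t < 0) || (0 < t) by rewrite -neq_lt.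
  apply/cvgrPdist_lt => e e0.
  have : \forall s \near t, s < 0 by exact: lt_nbhsl.
  apply: filterS => s s0.
  by rewrite /krn (le_gtF (ltW t0)) (le_gtF (ltW s0)) subrr normr0.
apply/cvgrPdist_lt => e e0.
have d : derivable (fun s => s `^ (x - 1)) t 1 by case: (is_derive1_powR (x - 1) t0).
have /differentiable_continuous/cvgrPdist_lt/(_ e e0) := (derivable1_diffP _ _).1 d.
have : \forall s \near t, 0 < s by exact: lt_nbhsr.
by apply: filterS2 => s s0; rewrite /krn s0 t0.
Qed.

Lemma krn_continuous x : 1 < x -> continuous (krn x).
Proof.
move=> x1 t; have [->|] := eqVneq t 0; last exact: krn_continuous_neq0.
apply/cvgrPdist_lt => e e0.
have -> : krn x 0 = 0 by rewrite /krn ltxx.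
have x10 : 0 < x - 1 by rewrite subr_gt0.
exists (e `^ (x - 1)^-1); first exact: powR_gt0.
move=> s /=; rewrite sub0r normrN => se.
rewrite sub0r normrN ger0_norm ?krn_ge0// /krn; case: ifP => // s0.
rewrite -[ltRHS](powRr1 (ltW e0)) -[X in e `^ X](mulVf (lt0r_neq0 x10)) powRrM.
by apply: gt0_ltr_powR => //; rewrite ?nnegrE ?powR_ge0 ?ltW// -(gtr0_norm s0).
Qed.

(** A ratio in ]0, 1] is at most its power of exponent x <= 1; the ratios of s and t to s + t add up
    to 1. *)
Lemma powR_subadditive x s t : 0 < x <= 1 -> 0 < s -> 0 <= t ->
  (s + t) `^ x <= s `^ x + t `^ x.
Proof.
move=> /andP[x0 x1] s0; rewrite le_eqVlt => /predU1P[<-|t0].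
  by rewrite addr0 lerDl powR_ge0.
have st0 : 0 < s + t by rewrite addr_gt0.
have h r : 0 < r <= s + t -> (s + t) `^ x * (r / (s + t)) <= r `^ x.
  move=> /andP[r0 rst]; rewrite mulrC.
  have {2}-> : r = r / (s + t) * (s + t) by rewrite divfK// lt0r_neq0.
  have rst0 : 0 <= r / (s + t) by rewrite divr_ge0// ltW.
  rewrite (powRM _ rst0 (ltW st0)); apply: ler_wpM2r; first exact: powR_ge0.
  by apply: ger1_powR => //; rewrite divr_gt0//= ler_pdivrMr// mul1r.
have hs : 0 < s <= s + t by rewrite s0 lerDl ltW.
have ht : 0 < t <= s + t by rewrite t0 lerDr ltW.
apply: le_trans (lerD (h _ hs) (h _ ht)).
by rewrite -mulrDr -mulrDl divff ?mulr1// lt0r_neq0.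
Qed.

Lemma le_krn x s t : 1 < x -> s <= t -> krn x s <= krn x t.
Proof.
move=> x1 st; rewrite /krn; case: (ltP 0 s) => s0.
  rewrite (lt_le_trans s0 st).
  have [s0' t0'] : 0 <= s /\ 0 <= t by split; lra.
  by apply: ge0_ler_powR; rewrite ?nnegrE//; lra.
by case: ifP => _ //; exact: powR_ge0.
Qed.

(** Subadditivity of the power x - 1, which lies in ]0, 1]. Used with x = alpha - 1, it is where
    alpha <= 3 enters, and it yields every Hoelder bound below. *)
Lemma krn_holder x s t : 1 < x <= 2 ->
  `|krn x s - krn x t| <= `|s - t| `^ (x - 1).
Proof.
move=> /andP[x1 x2]; wlog st : s t / s <= t.
  move=> h; have [/h//|/ltW/h] := leP s t.
  by rewrite distrC [X in X `^ _]distrC.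
have x01 : 0 < x - 1 <= 1 by rewrite subr_gt0 x1 lerBlDr.
rewrite distrC [X in X `^ _]distrC !ger0_norm ?subr_ge0//; last exact: le_krn.
rewrite lerBlDr /krn; case: (ltP 0 t) => t0; last first.
  by rewrite addr_ge0 ?powR_ge0//; case: ifP => // _; rewrite powR_ge0.
case: (ltP 0 s) => s0; last first.
  have [ts0 t0'] : 0 <= t - s /\ 0 <= t by split; lra.
  by rewrite addr0; apply: ge0_ler_powR; rewrite ?nnegrE//; lra.
by rewrite -{1}(subrK s t) addrC [leRHS]addrC powR_subadditive// subr_ge0.
Qed.

Lemma Rintegral_cvg (D : set (measurableTypeR R)) (f_ : nat -> R -> R) (f G : R -> R) :
  measurable D -> (forall n, measurable_fun D (f_ n)) -> measurable_fun D f ->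
  {ae mu, forall s, D s -> f_ ^~ s @ \oo --> f s} ->
  mu.-integrable D (EFin \o G) ->
  (forall n s, D s -> `|f_ n s| <= G s) ->
  mu.-integrable D (EFin \o f) /\
  (\int[mu]_(s in D) f_ n s) @[n --> \oo] --> \int[mu]_(s in D) f s.
Proof.
move=> mD mf_ mf ff iG fG.
have FF : Filter (almost_everywhere mu) := ae_filter_ringOfSetsType mu.
have [] := @dominated_convergence _ _ _ mu D mD (fun n => EFin \o f_ n)
  (EFin \o f) (EFin \o G).
- by move=> n; apply/measurable_EFinP; exact: mf_.
- exact/measurable_EFinP.
- by apply: filterS ff => s fs Ds; apply: cvg_EFin; [exact: nearW|exact: fs].
- exact: iG.
- by apply: aeW => s n Ds /=; rewrite lee_fin; exact: fG.
move=> intf _ c; split => //.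
apply: fine_cvg; rewrite /Rintegral fineK//; exact: integrable_fin_num.
Qed.

(* The kernels [k_ n] need not have an integrable majorant: convergence of their
   integrals replaces it, by dominated convergence for [(k - k_ n)^+ <= k]. *)
Lemma Rintegral_scheffe (D : set (measurableTypeR R)) (k_ : nat -> R -> R)
    (k g : R -> R) (B : R) :
  measurable D -> (forall n, mu.-integrable D (EFin \o k_ n)) ->
  mu.-integrable D (EFin \o k) ->
  (forall n s, D s -> 0 <= k_ n s) -> (forall s, D s -> 0 <= k s) ->
  {ae mu, forall s, D s -> k_ ^~ s @ \oo --> k s} ->
  (\int[mu]_(s in D) k_ n s) @[n --> \oo] --> \int[mu]_(s in D) k s ->
  measurable_fun D g -> (forall s, D s -> `|g s| <= B) ->
  (\int[mu]_(s in D) (k_ n s * g s)) @[n --> \oo] -->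
    \int[mu]_(s in D) (k s * g s).
Proof.
move=> mD ik_ ik k_0 k0 kk ikk mg gB.
have mk_ n : measurable_fun D (k_ n) by have /measurable_int/measurable_EFinP := ik_ n.
have mk : measurable_fun D k by have /measurable_int/measurable_EFinP := ik.
pose d n s := Num.max (k s - k_ n s) 0.
have md n : measurable_fun D (d n).
  by apply: measurable_maxr => //; exact: measurable_funB.
have d0 n s : 0 <= d n s by rewrite /d le_max lexx orbT.
have dk n s : D s -> d n s <= k s.
  by move=> Ds; rewrite /d ge_max k0// lerBlDr lerDl k_0.
have FF : Filter (almost_everywhere mu) := ae_filter_ringOfSetsType mu.
have [_ cd] : mu.-integrable D (EFin \o cst 0) /\
    (\int[mu]_(s in D) d n s) @[n --> \oo] --> \int[mu]_(s in D) (cst (0 : R) s).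
  apply: (@Rintegral_cvg D d (cst 0) k) => //.
  - apply: filterS kk => s ks Ds; rewrite /d/=.
    rewrite [X in _ --> X](_ : 0 = Num.max (k s - k s) 0); last first.
      by rewrite subrr maxxx.
    have cm : continuous (fun y : R => Num.max y 0).
      by move=> y; apply: (@continuous_max _ _ id (cst 0)) => //; exact: cst_continuous.
    apply: (@cvg_comp _ _ _ (fun n => k s - k_ n s) (fun y : R => Num.max y 0)
      _ (nbhs (k s - k s)) _ _ (cm _)).
    by apply: cvgB; [exact: cvg_cst|exact: ks].
  - by move=> n s Ds; rewrite ger0_norm//; exact: dk.
have id n : mu.-integrable D (EFin \o d n).
  apply: le_integrable ik => //; first by apply/measurable_EFinP; exact: md.
  by move=> s Ds; rewrite lee_fin/= !ger0_norm// ?dk// k0.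
rewrite Rintegral_cst// mul0r in cd.
have ib n : mu.-integrable D (EFin \o (fun s => k_ n s - k s)).
  by apply: eq_integrable (integrableB mD (ik_ n) ik).
(* From |y| = 2 max(-y, 0) + y with y = [k_ n s - k s]: the first integral tends to 0 by domination,
   the second by the assumed convergence of integrals. *)
have e n : \int[mu]_(s in D) `|k_ n s - k s| =
    2 * (\int[mu]_(s in D) d n s) + (\int[mu]_(s in D) k_ n s - \int[mu]_(s in D) k s).
  rewrite -RintegralB// -RintegralZl// -RintegralD//; last first.
    by have := integrableZl mD 2 (id n).
  apply: eq_Rintegral => s _; rewrite /d; case: leP => h.
    by rewrite ger0_norm; [lra|lra].
  by rewrite ltr0_norm; [lra|lra].
have c1 : (\int[mu]_(s in D) `|k_ n s - k s|) @[n --> \oo] --> (0 : R).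
  have c0 : 2 * (\int[mu]_(s in D) d n s) +
      (\int[mu]_(s in D) k_ n s - \int[mu]_(s in D) k s) @[n --> \oo] -->
      2 * 0 + (\int[mu]_(s in D) k s - \int[mu]_(s in D) k s).
    apply: cvgD; first exact: cvgMr.
    by apply: cvgB => //; exact: cvg_cst.
  move: c0; rewrite subrr mulr0 addr0; apply: cvg_trans; apply: near_eq_cvg.
  by apply: nearW => n; rewrite e.
have ig (h : R -> R) : mu.-integrable D (EFin \o h) ->
    mu.-integrable D (EFin \o (fun s => h s * g s)).
  move=> ih; have mh : measurable_fun D h by have /measurable_int/measurable_EFinP := ih.
  have := integrableZl mD B ih.
  apply: le_integrable => //; first exact/measurable_EFinP/measurable_funM.
  move=> s Ds; rewrite lee_fin/= !normrM mulrC ler_wpM2r//.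
  by rewrite (le_trans (gB _ Ds))// ler_norm.
apply/cvgrPdist_le => eps eps0.
have c2 : B * \int[mu]_(s in D) `|k_ n s - k s| @[n --> \oo] --> B * 0.
  exact: cvgMr.
move: c2; rewrite mulr0 => /cvgrPdist_le/(_ _ eps0); apply: filterS => n.
rewrite sub0r normrN => /(le_trans (ler_norm _)); apply: le_trans.
rewrite distrC -RintegralB//; [|exact: ig|exact: ig].
have ib2 : mu.-integrable D (EFin \o (fun s => k_ n s * g s - k s * g s)).
  by apply: eq_integrable (integrableB mD (ig _ (ik_ n)) (ig _ ik)).
apply: le_trans (le_normr_Rintegral mD ib2) _.
rewrite -RintegralZl//; last exact: integrable_norm.
apply: le_Rintegral => //; first exact: integrable_norm.
  by have := integrableZl mD B (integrable_norm (ib n)).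
by move=> s Ds; rewrite -mulrBl normrM mulrC ler_wpM2r// gB.
Qed.

Lemma RLint_exists_lt0 x (g : R -> R) t : t < 0 -> RLint_exists x g t.
Proof.
move=> t0; rewrite /RLint_exists set_itv_ge; first exact: integrable_set0.
by rewrite bnd_simp -ltNge.
Qed.

Lemma RLint_le0 x (g : R -> R) t : t <= 0 -> RLint x g t = 0.
Proof.
rewrite le_eqVlt => /predU1P[->|t0].
  by rewrite /RLint set_itv1 Rintegral_set1 mulr0.
rewrite /RLint set_itv_ge; first by rewrite Rintegral_set0 mulr0.
by rewrite bnd_simp -ltNge.
Qed.

(** The dependence on [t] moves from the domain of integration into the kernel, so that limits in
    [t] are taken over one fixed domain. *)
Lemma RLint_krn x (g : R -> R) t : RLint_exists x g t ->
  mu.-integrable `[0, +oo[ (EFin \o (fun s => krn x (t - s) * g s)) /\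
  RLint x g t = (Gamma x)^-1 * \int[mu]_(s in `[0, +oo[) (krn x (t - s) * g s).
Proof.
move=> ig; pose f s := (t - s) `^ (x - 1) * g s.
have i1 : mu.-integrable `[0, t[ (EFin \o f).
  apply: integrableS ig => // s /=; rewrite !in_itv/= => /andP[-> /ltW ->//].
have e : {in `[0, +oo[%classic, f \_ `[0, t[ =1 (fun s => krn x (t - s) * g s)}.
  move=> s; rewrite inE/= in_itv/= andbT => s0.
  rewrite patchE mem_setE in_itv/= s0/= /krn subr_gt0.
  by case: ifP => // _; rewrite mul0r.
split.
  have i2 : mu.-integrable setT (EFin \o f \_ `[0, t[).
    have /integrable_mkcond := i1; rewrite restrict_EFin; apply.
    exact: measurable_itv.
  have i3 : mu.-integrable `[0, +oo[ (EFin \o f \_ `[0, t[) by apply: integrableS i2.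
  by apply: eq_integrable i3 => // s sx /=; rewrite e.
rewrite /RLint; congr (_ * _).
rewrite -(@Rintegral_itv_bndo_bndc _ _ t)// Rintegral_mkcond [RHS]Rintegral_mkcond.
apply: eq_Rintegral => s _; rewrite [RHS]patchE; case: ifPn => [sx|].
  by rewrite -e.
rewrite mem_setE in_itv/= andbT => /negbTE s0.
by rewrite patchE mem_setE in_itv/= s0.
Qed.

Lemma RLint_exists_mulr x (a g : R -> R) (B t : R) :
  RLint_exists x a t -> measurable_fun `[0, t] (fun s => a s * g s) ->
  (forall s, 0 <= s <= t -> `|g s| <= B) ->
  RLint_exists x (fun s => a s * g s) t.
Proof.
move=> ia mag gB; have := @integrableZl _ _ _ mu `[0, t] (measurable_itv _) B _ ia.
apply: le_integrable => //.
  by apply/measurable_EFinP/measurable_funM => //; exact: measurable_powR_subl.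
move=> s; rewrite /= in_itv/= => /gB gs.
rewrite lee_fin mulrA normrM [X in _ <= X]normrM mulrC ler_wpM2r//.
by rewrite (le_trans gs)// ler_norm.
Qed.

(** Existence of the fractional integral at n + 1 contains measurability of the integrand, whose
    kernel factor does not vanish on [0, n] and can be divided out. *)
Lemma RLint_exists_measurable x (a : R -> R) :
  (forall t, 0 <= t -> RLint_exists x a t) -> measurable_fun (`[0, +oo[ : set R) a.
Proof.
move=> ia.
have mn (n : nat) : measurable_fun `[0, n%:R : R] a.
  have n1 : 0 <= n.+1%:R :> R by [].
  have /measurable_int/measurable_EFinP m1 := ia _ n1.
  have m2 : measurable_fun `[0, n%:R : R]
      (fun s => (n.+1%:R - s) `^ (1 - x) * ((n.+1%:R - s) `^ (x - 1) * a s)).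
    apply: measurable_funM; first exact: measurable_powR_subl.
    apply: measurable_funS m1 => // s /=; rewrite !in_itv/= => /andP[-> sn]/=.
    by rewrite (le_trans sn)// ler_nat.
  apply: eq_measurable_fun m2 => s; rewrite inE/= in_itv/= => /andP[s0 sn].
  have ns : 0 < n.+1%:R - s by rewrite subr_gt0 (le_lt_trans sn)// ltr_nat.
  rewrite mulrA -powRD; last by rewrite (gt_eqF ns) implybT.
  by rewrite addrA subrK subrr powRr0 mul1r.
rewrite itv_bndy_bigcup_BRight/=.
apply/measurable_fun_bigcup => n; first exact: measurable_itv.
by rewrite add0r.
Qed.

(** For x < 1 the kernel is singular at s = [u n], a point that moves with n, so no common majorant
    is at hand. Continuity of [RLint x a] is the convergence of integrals that replaces it. *)
Lemma continuous_RLint_bounded x (a g : R -> R) (B : R) :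
  (forall t, 0 <= t -> 0 <= a t) -> (forall t, 0 <= t -> RLint_exists x a t) ->
  continuous (RLint x a) -> measurable_fun setT g ->
  (forall s, `|g s| <= B) -> 0 < x ->
  continuous (RLint x (fun s => a s * g s)).
Proof.
move=> a0 ia ca mg gB x0 t.
have ma := RLint_exists_measurable ia.
have ia' r : RLint_exists x a r.
  by have [/ia//|] := leP 0 r; exact: RLint_exists_lt0.
have iag r : RLint_exists x (fun s => a s * g s) r.
  apply: (@RLint_exists_mulr _ _ _ B) => //.
  apply: measurable_funM; last exact: measurable_funTS.
  by apply: measurable_funS ma => // s /=; rewrite !in_itv/= => /andP[->].
pose G r := (Gamma x)^-1 * \int[mu]_(s in `[0, +oo[) (krn x (r - s) * (a s * g s)).
have -> : RLint x (fun s => a s * g s) = G.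
  by apply/funext => r; exact: (RLint_krn (iag r)).2.
apply/(@cvg_nbhsP _ R^o) => u ut; rewrite /G.
apply: cvgMr.
have e r : \int[mu]_(s in `[0, +oo[) (krn x (r - s) * (a s * g s)) =
    \int[mu]_(s in `[0, +oo[) (krn x (r - s) * a s * g s).
  by apply: eq_Rintegral => s _; rewrite mulrA.
rewrite e; under eq_fun do rewrite e.
have FF : Filter (almost_everywhere mu) := ae_filter_ringOfSetsType mu.
apply: (@Rintegral_scheffe _ (fun n s => krn x (u n - s) * a s)
  (fun s => krn x (t - s) * a s) g B) => //.
- by move=> n; exact: (RLint_krn (ia' (u n))).1.
- exact: (RLint_krn (ia' t)).1.
- by move=> n s; rewrite /= in_itv/= andbT => s0; rewrite mulr_ge0 ?krn_ge0 ?a0.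
- by move=> s; rewrite /= in_itv/= andbT => s0; rewrite mulr_ge0 ?krn_ge0 ?a0.
- apply: filterS (ae_neq t) => s st _; apply: cvgMl.
  apply: (@cvg_comp _ _ _ (fun n => u n - s) (krn x) _ (nbhs (t - s))).
    by apply: cvgB => //; exact: cvg_cst.
  by apply: krn_continuous_neq0; rewrite subr_eq0 eq_sym.
- have h r : \int[mu]_(s in `[0, +oo[) (krn x (r - s) * a s) = Gamma x * RLint x a r.
    by rewrite (RLint_krn (ia' r)).2 mulrA divff ?mul1r// Gamma_neq0.
  rewrite h; under eq_fun do rewrite h.
  by apply: cvgMr; exact: (cvg_comp _ _ ut (ca t)).
- exact: measurable_funTS.
Qed.

End RealAnalysis.

(** * Continuity criteria and compactness of Hoelder families *)

Section ContinuityCriteria.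
Context {R : realType}.
Local Notation mu := (@lebesgue_measure R).
Implicit Types x t : R.

Lemma hcont_continuous (g : R -> R) : (forall t, 0 <= t -> hcont g t) ->
  (forall t, t <= 0 -> g t = g 0) -> continuous g.
Proof.
move=> cg g0.
have -> : g = g \o (fun t => Num.max 0 t).
  by apply/funext => t /=; case: leP => // t0; rewrite g0// ltW.
apply: (@continuous_within_comp R R R [set t : R | 0 <= t] g (Num.max 0)).
- by apply/subspace_continuousP => t /= /cg.
- by move=> y; apply: (@continuous_max _ _ (cst 0) id) => //; exact: cst_continuous.
- by move=> t /=; rewrite le_max lexx.
Qed.

Lemma continuous_integrable_itv (g : R -> R) x : continuous g ->
  mu.-integrable `[0, x] (EFin \o g).
Proof. by move=> cg; apply: hcont_integrable => t _; exact/continuous_hcont/cg. Qed.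

Lemma holder_continuous (K x : R) (v : R -> R) : 0 < x -> 0 <= K ->
  (forall t s, `|v t - v s| <= K * `|t - s| `^ x) -> continuous v.
Proof.
move=> x0 K0 vK t; apply/cvgrPdist_le => e e0.
have K1 : 0 < K + 1 by rewrite ltr_wpDl.
exists ((e / (K + 1)) `^ x^-1); first by rewrite /= powR_gt0// divr_gt0.
move=> s /= ts; apply: le_trans (vK _ _) _.
have : `|t - s| `^ x <= e / (K + 1).
  have e1 : 0 <= e / (K + 1) by rewrite divr_ge0// ltW.
  rewrite -[leRHS](powRr1 e1) -[X in _ <= _ `^ X](mulVf (lt0r_neq0 x0)) powRrM.
  by apply: ge0_ler_powR; rewrite ?nnegrE ?powR_ge0// ltW.
have := powR_ge0 `|t - s| x.
move: (_ `^ _) => y y0; rewrite ler_pdivlMr// mulrC => h.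
by apply: le_trans h; rewrite ler_wpM2r// lerDl.
Qed.

(* Tychonoff on a product of segments indexed by the whole line: a cluster point
   need not be a sequential limit, but approximates along finite sets [G]. *)
Lemma cluster_prod_topology (v_ : nat -> R -> R) (b : R -> R) :
  (forall n t, `|v_ n t| <= b t) ->
  exists v : R -> R, forall (G : seq R) (eps : R) (N : nat), 0 < eps ->
    exists2 n, (N <= n)%N & forall r, r \in G -> `|v_ n r - v r| < eps.
Proof.
move=> vb.
pose F : set_system (prod_topology (fun _ : R => R : topologicalType)) :=
  v_ @ \oo.
have FF : ProperFilter F by exact: fmap_proper_filter.
have FB : F [set g | forall t : R, `[- b t, b t]%classic (g t)].
  by exists 0%N => // n _ t; rewrite /= in_itv/= -ler_norml.
have [v [_ clv]] := @tychonoff R (fun _ => R : topologicalType)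
  (fun t => `[- b t, b t]%classic) (fun t => @segment_compact _ _ _) F FF FB.
exists v => G eps N eps0.
pose B : set (prod_topology (fun _ : R => R : topologicalType)) :=
  [set g | forall r, r \in G -> `|g r - v r| < eps].
have nB : nbhs v B.
  rewrite /B; elim: (G) => [|r G' ih].
    by apply: (filterS _ (@filterT _ (nbhs v) _)) => g _ r; rewrite in_nil.
  have h : nbhs v [set g : prod_topology (fun _ : R => R : topologicalType) |
      `|g r - v r| < eps].
    have := @proj_continuous R (fun _ => R : topologicalType) r v.
    move=> /(_ [set y | `|y - v r| < eps]); apply.
    by exists eps => //= y /=; rewrite distrC.
  apply: filterS2 h ih => g /= gr gG y; rewrite in_cons => /predU1P[->//|].
  exact: gG.
have FA : F [set v_ n | n in [set n | (N <= n)%N]].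
  by exists N => // n /= Nn; exists n.
have [g [[n Nn <-] gB]] := clv _ _ FA nB.
by exists n.
Qed.

(** The value 0 at 0 bounds each v_n(t) by K |t|^x, which gives a cluster point [v]. Choosing the
    k-th index for closeness on a finite grid, the common Hoelder modulus carries the estimate
    between grid points, and [k <= nu k] is all that is asked of the indices. *)
Lemma holder_compact (K x : R) (v_ : nat -> R -> R) : 0 < x -> 0 <= K ->
  (forall n t s, `|v_ n t - v_ n s| <= K * `|t - s| `^ x) ->
  (forall n, v_ n 0 = 0) ->
  exists nu : nat -> nat, exists v : R -> R,
    [/\ forall k, (k <= nu k)%N,
        forall t s, `|v t - v s| <= K * `|t - s| `^ x &
        forall t, v_ (nu k) t @[k --> \oo] --> v t].
Proof.
move=> x0 K0 vK v0.
have [|v hv] := @cluster_prod_topology v_ (fun t => K * `|t| `^ x).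
  by move=> n t; have := vK n t 0; rewrite v0 !subr0.
have vH t s : `|v t - v s| <= K * `|t - s| `^ x.
  apply/ler_addgt0Pr => eps eps0.
  have e20 : 0 < eps / 2 by rewrite divr_gt0.
  have [n _ hn] := hv [:: t; s] (eps / 2) 0%N e20.
  have h1 := hn t (mem_head _ _).
  have h2 : `|v_ n s - v s| < eps / 2 by apply: hn; rewrite !inE eqxx orbT.
  rewrite (_ : v t - v s = - (v_ n t - v t) + (v_ n t - v_ n s) + (v_ n s - v s)); last by ring.
  rewrite (le_trans (ler_normD _ _))//.
  have := ler_normD (- (v_ n t - v t)) (v_ n t - v_ n s).
  rewrite normrN; have := vK n t s; lra.
(* Mesh 1/(k+1) over [-(k+1), k+1]: both the spacing and the range improve with k, so every [t] is
   eventually within the mesh of a grid point. *)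
pose grid k := [seq i%:R / k.+1%:R - k.+1%:R : R | i <- iota 0 (2 * k.+1 ^ 2).+1].
have /choice[nu hnu] : forall k, exists n, (k <= n)%N /\
    forall r, r \in grid k -> `|v_ n r - v r| < k.+1%:R^-1.
  move=> k; have k0 : 0 < (k.+1%:R : R)^-1 by rewrite invr_gt0.
  by have [n kn hn] := hv (grid k) k.+1%:R^-1 k k0; exists n.
exists nu, v; split => //; first by move=> k; have [] := hnu k.
move=> t; apply/cvgrPdist_le => eps eps0.
have c0 : 2 * K * krn (x + 1) (k.+1%:R^-1) + k.+1%:R^-1 @[k --> \oo] --> (0 : R).
  rewrite [X in _ --> X](_ : 0 = 2 * K * krn (x + 1) 0 + 0); last first.
    by rewrite /krn ltxx mulr0 addr0.
  apply: cvgD; last exact: cvg_harmonic.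
  apply: cvgMr.
  apply: (@cvg_comp _ _ _ (fun k : nat => k.+1%:R^-1 : R) (krn (x + 1)) _ (nbhs 0)).
    exact: cvg_harmonic.
  by apply: krn_continuous; rewrite ltrDr.
move/cvgrPdist_le: c0 => /(_ _ eps0).
have : \forall k \near \oo, `|t| <= k.+1%:R.
  exists (Num.truncn `|t|) => // k /= tk.
  apply: le_trans (ltW (truncnS_gt _)) _.
  by rewrite ler_nat ltnS.
apply: filterS2 => k tk; rewrite sub0r normrN => /(le_trans (ler_norm _)).
apply: le_trans.
have k0 : 0 < k.+1%:R :> R by [].
have kn0 : (k.+1%:R : R) != 0 by exact: lt0r_neq0.
pose y := (t + k.+1%:R) * k.+1%:R.
move: tk; rewrite ler_norml => /andP[t1 t2].
have y0 : 0 <= y by rewrite mulr_ge0//; lra.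
pose i := Num.truncn y.
have /andP[iy yi] := truncn_itv y0.
pose r : R := i%:R / k.+1%:R - k.+1%:R.
have rG : r \in grid k.
  apply/mapP; exists i => //; rewrite mem_iota/= add0n ltnS.
  have : (i%:R : R) <= (2 * k.+1 ^ 2)%:R.
    apply: le_trans iy _; rewrite /y natrM natrX expr2 mulrA ler_wpM2r//; lra.
  by rewrite ler_nat.
have [_ /(_ _ rG) hr] := hnu k.
have tr : `|t - r| <= k.+1%:R^-1.
  have -> : t - r = (y - i%:R) / k.+1%:R by rewrite /r /y; field.
  rewrite normrM normfV (gtr0_norm k0) ler_piMl ?invr_ge0 ?ltW// ger0_norm; lra.
have trx : `|t - r| `^ x <= krn (x + 1) k.+1%:R^-1.
  rewrite /krn invr_gt0 k0 addrK; apply: ge0_ler_powR; rewrite ?nnegrE// ltW//.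
have := vK (nu k) t r; have := vH t r.
have : K * `|t - r| `^ x <= K * krn (x + 1) k.+1%:R^-1 by rewrite ler_wpM2l.
rewrite (_ : v t - v_ (nu k) t = (v t - v r) - (v_ (nu k) r - v r)
  - (v_ (nu k) t - v_ (nu k) r)); last by ring.
have := ler_normB (v t - v r - (v_ (nu k) r - v r)) (v_ (nu k) t - v_ (nu k) r).
have := ler_normB (v t - v r) (v_ (nu k) r - v r).
move=> h1 h2 h3 h4 h5; apply: le_trans h2 _; apply: le_trans (lerD h1 h5) _.
have -> : 2 * K * krn (x + 1) k.+1%:R^-1 + k.+1%:R^-1 =
  K * krn (x + 1) k.+1%:R^-1 + k.+1%:R^-1 + K * krn (x + 1) k.+1%:R^-1 by ring.
by rewrite !lerD//; [exact: le_trans h4 h3|exact: ltW].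
Qed.

(** The primitive of [g] is squeezed between 0 and the total integral, hence constant, and its
    derivative is [g], at 0 as well. *)
Lemma integral_eq0_continuous (g : R -> R) : continuous g -> (forall t, 0 <= t -> 0 <= g t) ->
  mu.-integrable `[0, +oo[ (EFin \o g) -> \int[mu]_(s in `[0, +oo[) g s <= 0 ->
  forall t, 0 <= t -> g t = 0.
Proof.
move=> cg g0 ig I0.
have z x : 0 <= x -> \int[mu]_(s in `[0, x]) g s = 0.
  move=> x0; apply/eqP; rewrite eq_le; apply/andP; split; last first.
    by apply: Rintegral_ge0 => s; rewrite /= in_itv/= => /andP[/g0].
  apply: le_trans I0.
  have sub : `[0, x] `<=` (`[0, +oo[ : set R).
    by move=> s /=; rewrite !in_itv/= => /andP[->].
  have ix : mu.-integrable `[0, x] (EFin \o g) by apply: integrableS ig.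
  rewrite /Rintegral fine_le//; [exact: integrable_fin_num|exact: integrable_fin_num|].
  apply: ge0_subset_integral => //; first by have /measurable_int := ig.
  by move=> s; rewrite /= in_itv/= andbT lee_fin => /g0.
move=> t t0.
have d1 : is_hderive (fun x => \int[mu]_(s in `[0, x]) g s) t (g t).
  apply: FTC_half_line => //; last exact/continuous_hcont/cg.
  by move=> x; exact: continuous_integrable_itv.
have d2 : is_hderive (fun x => \int[mu]_(s in `[0, x]) g s) t 0.
  rewrite /is_hderive; apply: (@cvg_trans _ ((fun=> 0) @ within [set h | 0 <= h + t] 0^')).
    apply: near_eq_cvg; apply: near_withinW => r /= r0.
    by rewrite /hquot !z// subrr scaler0.
  exact: cvg_cst.
by have [_ <-] := is_hderiveP t0 d1; have [_ ->] := is_hderiveP t0 d2.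
Qed.

End ContinuityCriteria.

(** * Fractional derivatives *)

Section RLOperations.
Context {R : realType}.
Local Notation mu := (@lebesgue_measure R).
Implicit Types (x y s t nu c : R) (g h : R -> R).

Lemma eq_RLint_exists x g1 g2 t : (forall s, 0 <= s <= t -> g1 s = g2 s) ->
  RLint_exists x g1 t -> RLint_exists x g2 t.
Proof.
move=> g12; apply: eq_integrable => // s; rewrite inE/= in_itv/= => /g12 ->//.
Qed.

Lemma eq_RLint x g1 g2 t : (forall s, 0 <= s <= t -> g1 s = g2 s) ->
  RLint x g1 t = RLint x g2 t.
Proof.
move=> g12; congr (_ * _); apply: eq_Rintegral => s.
by rewrite inE/= in_itv/= => /g12 ->.
Qed.

Lemma RLint_existsZ x c g t : RLint_exists x g t ->
  RLint_exists x (fun s => c * g s) t.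
Proof.
move=> ig; have := @integrableZl _ _ _ mu `[0, t] (measurable_itv _) c _ ig.
by apply: eq_integrable => // s _; rewrite -EFinM mulrCA.
Qed.

Lemma RLintZ x c g t : RLint_exists x g t ->
  RLint x (fun s => c * g s) t = c * RLint x g t.
Proof.
move=> ig; rewrite /RLint mulrCA; congr (_ * _).
by rewrite -RintegralZl//; apply: eq_Rintegral => s _; rewrite mulrCA.
Qed.

Lemma RLint_existsB x g h t : RLint_exists x g t -> RLint_exists x h t ->
  RLint_exists x (fun s => g s - h s) t.
Proof.
move=> ig ih; have := @integrableB _ _ _ mu `[0, t] (measurable_itv _) _ _ ig ih.
by apply: eq_integrable => // s _; rewrite /= -EFinB mulrBr.
Qed.

Lemma RLintB x g h t : RLint_exists x g t -> RLint_exists x h t ->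
  RLint x (fun s => g s - h s) t = RLint x g t - RLint x h t.
Proof.
move=> ig ih; rewrite /RLint -mulrBr; congr (_ * _).
by rewrite -RintegralB//; apply: eq_Rintegral => s _; rewrite mulrBr.
Qed.

Lemma RLint1 g t : RLint 1 g t = \int[mu]_(s in `[0, t]) g s.
Proof.
rewrite /RLint Gamma1 invr1 mul1r; apply: eq_Rintegral => s _.
by rewrite subrr powRr0 mul1r.
Qed.

Lemma RLint_exists1 g t : RLint_exists 1 g t <-> mu.-integrable `[0, t] (EFin \o g).
Proof.
by split; apply: eq_integrable => // s _ /=; rewrite subrr powRr0 mul1r.
Qed.

Lemma continuous_RLint_exists x g t : 0 < x -> continuous g -> RLint_exists x g t.
Proof.
move=> x0 cg; have [t0|] := leP 0 t; last exact: RLint_exists_lt0.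
have [M hM] : exists M, forall s, 0 <= s <= t -> `|g s| <= M.
  have := continuous_compact (continuous_subspaceT cg) (@segment_compact _ 0 t).
  move=> /compact_bounded[M [_ hM]]; exists (M + 1) => s st.
  by apply: (hM (M + 1)); [rewrite ltrDl|exists s => //=; rewrite in_itv].
(* The power with exponent 1 - 1 is the constant 1, in the form covered by [RLint_powR_exists]. *)
have h : RLint_exists x (fun s => s `^ (1 - 1) * g s) t.
  apply: (@RLint_exists_mulr _ _ _ _ M) => //.
  - exact: RLint_powR_exists.
  - apply: measurable_funM; first by apply: measurable_funTS; exact: measurable_powR.
    by apply: measurable_funTS; exact: continuous_measurable_fun.
by apply: eq_RLint_exists h => s _; rewrite subrr powRr0 mul1r.
Qed.

(** On [0, t[ the kernel of order y is at most t^(y - x) times that of order x. The end s = t is set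
    aside since exponents do not add for base 0. *)
Lemma RLint_exists_le x y g t : 0 < x -> x <= y -> measurable_fun (`[0, t] : set R) g ->
  RLint_exists x g t -> RLint_exists y g t.
Proof.
move=> x0 xy mg ig.
have my : measurable_fun (`[0, t] : set R) (fun s => (t - s) `^ (y - 1) * g s).
  by apply: measurable_funM => //; exact: measurable_powR_subl.
have sub : `[0, t[ `<=` (`[0, t] : set R).
  by move=> s /=; rewrite !in_itv/= => /andP[-> /ltW].
have i1 : mu.-integrable `[0, t[ (fun s => ((t - s) `^ (y - 1) * g s)%:E).
  have i2 : mu.-integrable `[0, t[ (fun s => ((t - s) `^ (x - 1) * g s)%:E).
    by apply: integrableS ig.
  have := @integrableZl _ _ _ mu `[0, t[ (measurable_itv _) (t `^ (y - x)) _ i2.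
  apply: le_integrable => //; first by apply/measurable_EFinP; exact: measurable_funS my.
  move=> s; rewrite /= in_itv/= => /andP[s0 st]; rewrite lee_fin.
  have ts : 0 < t - s by rewrite subr_gt0.
  have -> : y - 1 = (y - x) + (x - 1) by ring.
  rewrite powRD; last by rewrite (gt_eqF ts) implybT.
  rewrite -mulrA normrM [leRHS]normrM ler_wpM2r// !ger0_norm ?powR_ge0//.
  have [yx tt] : 0 <= y - x /\ 0 <= t by split; lra.
  by apply: ge0_ler_powR; rewrite ?nnegrE//; lra.
apply/integrableP; split; first exact/measurable_EFinP.
have /integrableP[_] := i1; rewrite integral_itv_bndo_bndc//.
by apply/measurable_EFinP; apply: measurableT_comp => //; exact: measurable_funS my.
Qed.

Lemma RLorder_gt nu : 0 <= nu -> 0 < (RLorder nu)%:R - nu.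
Proof. by move=> nu0; rewrite subr_gt0 /RLorder truncnS_gt. Qed.

Lemma RLkernelE nu g t s :
  RLkernel nu g t s = (t - s) `^ ((RLorder nu)%:R - nu - 1) * g s.
Proof.
rewrite /RLkernel -powRN mulrC; congr (_ `^ _ * _); ring.
Qed.

Lemma RLprimitiveE nu g t : 0 <= nu ->
  RLprimitive nu g t = Gamma ((RLorder nu)%:R - nu) * RLint ((RLorder nu)%:R - nu) g t.
Proof.
move=> nu0; rewrite /RLint mulrA divff ?mul1r ?Gamma_neq0 ?RLorder_gt//.
by apply: eq_Rintegral => s _; rewrite RLkernelE.
Qed.

(** [G] lists successive primitives of the derivative sought; the integral of complementary order
    lands at index [RLorder nu], and integer differentiation descends from there. *)
Lemma RLderiveP nu g (G : nat -> R -> R) t l : 0 <= nu -> 0 <= t ->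
  (forall x, 0 <= x -> RLint_exists ((RLorder nu)%:R - nu) g x) ->
  (forall s, 0 <= s -> RLint ((RLorder nu)%:R - nu) g s = G (RLorder nu) s) ->
  (forall k s, 0 <= s -> is_hderive (G k.+2) s (G k.+1 s)) ->
  is_hderive (G 1%N) t l ->
  RLderive_exists nu g t /\ RLderive nu g t = l.
Proof.
move=> nu0 t0 ig gG GS G1.
have Gm := Gamma_neq0 (RLorder_gt nu0).
set m := Gamma ((RLorder nu)%:R - nu) in Gm.
have [] := @hnderive_chain _ (fun k s => m * G k s) t (m * l) t0 _ _ (RLorder nu)
  (RLprimitive nu g).
- by move=> k s s0; apply: is_hderiveZ; exact: GS.
- exact: is_hderiveZ.
- by [].
- by move=> s s0; rewrite RLprimitiveE// gG.
move=> d1 d2; split; last by rewrite /RLderive d2 mulrA mulVf ?mul1r.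
split => // x x0; have := ig x x0; apply: eq_integrable => // s _.
by rewrite /= RLkernelE.
Qed.

Section Profile.
Variables (c : R) (h : R -> R).
Hypotheses (h_cont : continuous h) (h_ge0 : forall t, 0 <= h t).

(* The solution [u] of the problem has the form [profile c h alpha], where
   [h = - D^alpha u]; then [u' = profile c h (alpha - 1)] and
   [D^(alpha - 1) u = profile c h 1]. *)
Definition profile x t := c / Gamma x * t `^ (x - 1) - RLint x h t.

(** Fractional integration only shifts the index, by the Beta formula for the power and the
    semigroup law for [h]. Profiles of integer index thus form the chain of primitives wanted by
    [RLderiveP]. *)
Lemma RLint_profile x y t : 0 < x -> 0 < y -> 1 < x + y -> 0 <= t ->
  RLint_exists x (profile y) t /\ RLint x (profile y) t = profile (x + y) t.
Proof.
move=> x0 y0 xy t0.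
have e1 := RLint_powR_exists x0 y0 t0.
have mh : measurable_fun (`[0, t] : set R) h.
  by apply: measurable_funTS; exact: continuous_measurable_fun.
have eh z s : 0 < z -> RLint_exists z h s.
  by move=> z0; exact: continuous_RLint_exists.
have e2 : RLint_exists x (RLint y h) t.
  apply: RLint_RLint_exists => // [s _|]; apply: eh => //.
  by rewrite (lt_trans _ xy).
split; first by apply: RLint_existsB e2; exact: RLint_existsZ.
rewrite RLintB//; last exact: RLint_existsZ.
rewrite RLintZ// RLint_powR// RLint_RLint//; last 2 first.
- by move=> s _; exact: eh.
- by apply: eh; rewrite (lt_trans _ xy).
have := Gamma_neq0 (addr_gt0 x0 y0); have := Gamma_neq0 y0; rewrite /profile.
move: (Gamma y) (Gamma (x + y)) (_ `^ _) (RLint _ _ _) => a b p r a0 b0.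
by congr (_ - _); field; rewrite a0 b0.
Qed.

Lemma profileS k t : 0 <= t ->
  profile k.+2%:R t = \int[mu]_(s in `[0, t]) profile k.+1%:R s.
Proof.
move=> t0; rewrite -RLint1.
have [||_ ->] := @RLint_profile 1 k.+1%:R t ltr01 _ _ t0; first by [].
  by rewrite ltrDl.
by rewrite nat1r.
Qed.

Lemma profile1 t : profile 1 t = c + - \int[mu]_(s in `[0, t]) h s.
Proof. by rewrite /profile Gamma1 subrr powRr0 divr1 mulr1 RLint1. Qed.

Lemma profile_hcont k t : 0 <= t -> hcont (profile k.+1%:R) t.
Proof.
elim: k t => [|k ih] t t0; last first.
  apply: (@eq_hcont _ (fun t => \int[mu]_(s in `[0, t]) profile k.+1%:R s)) => //.
    by move=> s s0; rewrite profileS.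
  by apply: hcont_integral => // x; apply: hcont_integrable.
rewrite /hcont; under eq_fun do rewrite profile1.
rewrite profile1; apply: cvgD; first exact: cvg_cst.
apply: cvgN; apply: hcont_integral => // x.
exact: continuous_integrable_itv.
Qed.

Lemma is_hderive_profileS k t : 0 <= t ->
  is_hderive (profile k.+2%:R) t (profile k.+1%:R t).
Proof.
move=> t0.
apply: (@eq_is_hderive _ (fun t => \int[mu]_(s in `[0, t]) profile k.+1%:R s)) => //.
  by move=> s s0; rewrite profileS.
apply: FTC_half_line => //; last exact: profile_hcont.
by move=> x; apply: hcont_integrable => s; exact: profile_hcont.
Qed.

Lemma is_hderive_profile1 t : 0 <= t -> is_hderive (profile 1) t (- h t).
Proof.
move=> t0.
have -> : profile 1 = fun t => c + -1 * \int[mu]_(s in `[0, t]) h s.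
  by apply/funext => s; rewrite profile1 mulN1r.
apply: is_hderiveD_cst; rewrite (_ : - h t = -1 * h t); last by rewrite mulN1r.
apply: is_hderiveZ.
apply: FTC_half_line => //; last exact/continuous_hcont/h_cont.
by move=> x; exact: continuous_integrable_itv.
Qed.

(** With n the order of the derivative, integration of order n - y lands on [profile n], whose n-th
    derivative is - h. For order y - 1 it lands one index higher relative to the number of
    derivatives, so the descent ends at [profile 1]. *)
Lemma RLderive_profile y t (u : R -> R) : 1 < y -> 0 <= t ->
  (forall s, 0 <= s -> u s = profile y s) ->
  (RLderive_exists y u t /\ RLderive y u t = - h t) /\
  (RLderive_exists (y - 1) u t /\ RLderive (y - 1) u t = profile 1 t).
Proof.
move=> y1 t0 uP; have y0 : 0 <= y by lra.
have y10 : 0 <= y - 1 by lra.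
have key d s : 0 < d -> 1 < d + y -> 0 <= s ->
    RLint_exists d u s /\ RLint d u s = profile (d + y) s.
  move=> d0 dy s0; have yp : 0 < y by lra.
  have [e1 e2] := RLint_profile d0 yp dy s0.
  have e r : 0 <= r <= s -> profile y r = u r by move=> /andP[r0 _]; exact/esym/uP.
  split; first exact: (eq_RLint_exists e e1).
  exact: etrans (esym (eq_RLint d e)) e2.
have n0 := RLorder_gt y0; have n1 := RLorder_gt y10.
split.
  apply: (RLderiveP (G := fun k => profile k%:R) y0 t0).
  - by move=> x x0; apply: (key _ _ _ _ x0).1 => //; move: (RLorder y) n0 => n n0; lra.
  - move=> s s0; move: (RLorder y) n0 => n n0.
    by rewrite (key _ _ n0 _ s0).2 ?subrK//; lra.
  - by move=> k s s0; exact: is_hderive_profileS.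
  - exact: is_hderive_profile1.
apply: (RLderiveP (G := fun k => profile k.+1%:R) y10 t0).
- by move=> x x0; apply: (key _ _ _ _ x0).1 => //; move: (RLorder _) n1 => n n1; lra.
- move=> s s0; move: (RLorder _) n1 => n n1.
  rewrite (key _ _ n1 _ s0).2; last by lra.
  by rewrite (_ : n%:R - (y - 1) + y = n.+1%:R)// -natr1; ring.
- by move=> k s s0; exact: is_hderive_profileS.
- exact: is_hderive_profileS.
Qed.

End Profile.

(** The derivative of order gam inverts the integral wherever the primitive of [g] has derivative
    [g]. As [RLorder gam] is 1 for gam < 1 but 2 for gam = 1, the chain needs all integer orders. *)
Lemma RLderive_RLint gam g (w : R -> R) t : 0 < gam <= 1 -> 0 <= t ->
  (forall x, measurable_fun (`[0, x] : set R) g) ->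
  (forall s, 0 <= s -> 0 <= g s) ->
  (forall x, 0 <= x -> RLint_exists gam g x) ->
  (forall s, 0 <= s -> w s = - RLint gam g s) ->
  is_hderive (fun y => \int[mu]_(s in `[0, y]) g s) t (g t) ->
  RLderive_exists gam w t /\ RLderive gam w t = - g t.
Proof.
move=> /andP[gam0 gam1] t0 mg g0 ig wE dg.
have n0 := RLorder_gt (ltW gam0).
have g0' x s : 0 <= s <= x -> 0 <= g s by move=> /andP[s0 _]; exact: g0.
have ig' x s : 0 <= s <= x -> RLint_exists gam g s by move=> /andP[s0 _]; exact: ig.
have ign (k : nat) x : 0 <= x -> RLint_exists k.+1%:R g x.
  move=> x0; apply: RLint_exists_le (ig _ x0) => //.
  by rewrite (le_trans gam1)// ler1n.
have e1 x : 0 <= x -> RLint_exists ((RLorder gam)%:R - gam) (RLint gam g) x.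
  move=> x0; apply: RLint_RLint_exists => //; first exact: g0'.
    exact: ig'.
  by rewrite subrK; exact: ign.
have ew x : 0 <= x -> RLint_exists ((RLorder gam)%:R - gam) w x.
  move=> x0; apply: eq_RLint_exists (RLint_existsZ (-1) (e1 _ x0)) => s /andP[s0 _].
  by rewrite wE// mulN1r.
have S k x : 0 <= x -> RLint k.+2%:R g x =
    \int[mu]_(s in `[0, x]) RLint k.+1%:R g s.
  move=> x0; rewrite -RLint1 RLint_RLint ?nat1r//; first exact: g0'.
    by move=> s /andP[s0 _]; exact: ign.
  exact: ign.
have ig1 x : mu.-integrable `[0, x] (EFin \o g).
  apply/RLint_exists1; have [x0|] := leP 0 x; last exact: RLint_exists_lt0.
  exact: (ign 0%N).
have hc k s : 0 <= s -> hcont (RLint k.+1%:R g) s.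
  elim: k s => [|k ih] s s0.
    rewrite (_ : RLint _ _ = fun y => \int[mu]_(s in `[0, y]) g s).
      exact: hcont_integral.
    by apply/funext => y; rewrite RLint1.
  apply: (@eq_hcont _ (fun t => \int[mu]_(s in `[0, t]) RLint k.+1%:R g s)) => //.
    by move=> r r0; rewrite S.
  by apply: hcont_integral => // x; exact: hcont_integrable.
apply: (@RLderiveP gam w (fun k s => -1 * RLint k%:R g s)) => //; first exact: ltW.
- move=> s s0; rewrite -[RHS]RLintZ.
    have e2 : RLint ((RLorder gam)%:R - gam) (RLint gam g) s = RLint (RLorder gam)%:R g s.
      rewrite RLint_RLint ?subrK//; [exact: g0'|exact: ig'|exact: ign].
    rewrite RLintZ; last exact: ign.
    rewrite -e2 -RLintZ; last exact: e1.
    by apply: eq_RLint => r /andP[r0 _]; rewrite wE// mulN1r.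
  exact: ign.
- move=> k s s0; apply: is_hderiveZ.
  apply: (@eq_is_hderive _ (fun t => \int[mu]_(s in `[0, t]) RLint k.+1%:R g s)) => //.
    by move=> r r0; rewrite S.
  apply: FTC_half_line => //; last exact: hc.
  by move=> x; apply: hcont_integrable => r; exact: hc.
- rewrite (_ : - g t = -1 * g t); last by rewrite mulN1r.
  apply: is_hderiveZ.
  rewrite (_ : RLint _ _ = fun y => \int[mu]_(s in `[0, y]) g s)//.
  by apply/funext => y; rewrite RLint1.
Qed.

End RLOperations.

(** * The Volterra operator and its fixed point *)

Section Operator.
Context {R : realType}.
Local Notation mu := (@lebesgue_measure R).
Implicit Types (x s t c e : R) (h v : R -> R).
Variables (A gam q B : R) (a : R -> R) (F : R -> R -> R -> R).
Hypotheses (A_gt1 : 1 < A) (A_le2 : A <= 2) (gam_gt0 : 0 < gam) (q_gt1 : 1 < q).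
Hypothesis a_ge0 : forall t, 0 <= t -> 0 <= a t.
Hypothesis a_RLint : forall t, 0 <= t -> RLint_exists gam a t.
Hypothesis a_cont : continuous (RLint gam a).
Hypothesis F_bnd : forall t x y, 0 <= F t x y <= B.
Hypothesis F_cont : continuous (fun z : R * R * R => F z.1.1 z.1.2 z.2).

(** The bound phi_q (I^gamma (B a)) for [h]; [krn q] agrees with [phi q] on nonnegative numbers. *)
Definition majorant t := krn q (B * RLint gam a t).
Hypothesis int_majorant : mu.-integrable `[0, +oo[ (EFin \o majorant).

(* [A] stands for [alpha - 1], and the unknown is the derivative [v] of the
   solution, [antider v] being the solution itself.  The delay [e] makes
   [velocity c e h] on [(-oo, x + e]] depend on [h] only through [(-oo, x]]. *)
Definition antider (v : R -> R) t := \int[mu]_(s in `[0, t]) v s.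
Definition source v s := a s * F s (antider v s) (v s).
Definition forcing v t := krn q (RLint gam (source v) t).
Definition velocity c e h t := (Gamma A)^-1 *
  (c * krn A t - \int[mu]_(s in `[0, +oo[) (krn A (t - e - s) * h s)).

Definition admissible h :=
  continuous (h : R -> R) /\ forall t, 0 <= h t <= majorant t.

Lemma antider_le0 v t : t <= 0 -> antider v t = 0.
Proof.
rewrite le_eqVlt => /predU1P[->|t0]; first by rewrite /antider set_itv1 Rintegral_set1.
by rewrite /antider set_itv_ge ?Rintegral_set0// bnd_simp -ltNge.
Qed.

Lemma continuous_antider v : continuous v -> continuous (antider v).
Proof.
move=> cv; apply: hcont_continuous.
  by move=> t t0; apply: hcont_integral => // x; exact: continuous_integrable_itv.
by move=> t t0; rewrite !antider_le0.
Qed.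

Lemma continuous_F3 (u v : R -> R) : continuous u -> continuous v ->
  continuous (fun s => F s (u s) (v s)).
Proof.
move=> cu cv s.
have pc : (r, u r, v r) @[r --> s] --> (s, u s, v s).
  exact: (cvg_pair (cvg_pair (@cvg_id _ (nbhs s)) (cu s)) (cv s)).
have := cvg_comp _ _ pc (@F_cont (s, u s, v s)); exact.
Qed.

Lemma norm_F t x y : `|F t x y| <= B.
Proof. by have /andP[F0 FB] := F_bnd t x y; rewrite ger0_norm. Qed.

Lemma measurable_F3 u v : continuous u -> continuous v ->
  measurable_fun setT (fun s => F s (u s) (v s)).
Proof. by move=> cu cv; apply: continuous_measurable_fun; exact: continuous_F3. Qed.

Lemma measurable_a t : measurable_fun (`[0, t] : set R) a.
Proof.
apply: measurable_funS (RLint_exists_measurable a_RLint) => //.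
by move=> s /=; rewrite !in_itv/= => /andP[->].
Qed.

Lemma measurable_source v t : continuous v ->
  measurable_fun (`[0, t] : set R) (source v).
Proof.
move=> cv; apply: measurable_funM; first exact: measurable_a.
by apply: measurable_funTS; apply: measurable_F3 => //; exact: continuous_antider.
Qed.

Lemma RLint_a_exists t : RLint_exists gam a t.
Proof. by have [/a_RLint//|] := leP 0 t; exact: RLint_exists_lt0. Qed.

Lemma source_RLint v t : continuous v -> RLint_exists gam (source v) t.
Proof.
move=> cv; apply: (@RLint_exists_mulr _ _ _ _ B) => [||s _].
- exact: RLint_a_exists.
- exact: measurable_source.
- exact: norm_F.
Qed.

Lemma source_ge0 v s : 0 <= s -> 0 <= source v s.
Proof. by move=> s0; rewrite mulr_ge0 ?a_ge0//; have /andP[] := F_bnd s (antider v s) (v s). Qed.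

Lemma RLint_source_ge0 v t : 0 <= RLint gam (source v) t.
Proof. by apply: RLint_ge0 => // s /andP[s0 _]; exact: source_ge0. Qed.

Lemma RLint_source_le v t : continuous v ->
  RLint gam (source v) t <= B * RLint gam a t.
Proof.
move=> cv; rewrite /RLint mulrCA ler_wpM2l ?invr_ge0 ?(ltW (Gamma_gt0 _))//.
rewrite -RintegralZl//; last exact: RLint_a_exists.
apply: le_Rintegral => //; first exact: source_RLint.
  exact: (@integrableZl _ _ _ mu `[0, t] (measurable_itv _) B _ (RLint_a_exists t)).
move=> s; rewrite /= in_itv/= => /andP[s0 _].
rewrite [leRHS]mulrCA ler_wpM2l ?powR_ge0// /source mulrC ler_wpM2r ?a_ge0//.
by have /andP[] := F_bnd s (antider v s) (v s).
Qed.

Lemma forcing_admissible v : continuous v -> admissible (forcing v).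
Proof.
move=> cv; split; last first.
  by move=> t; rewrite krn_ge0/= le_krn// RLint_source_le.
have c1 : continuous (RLint gam (source v)).
  apply: (@continuous_RLint_bounded _ _ _ _ B) => //.
  - by apply: measurable_F3 => //; exact: continuous_antider.
  - by move=> s; exact: norm_F.
move=> t; apply: (@continuous_comp _ _ _ (RLint gam (source v)) (krn q)).
  exact: c1.
exact: krn_continuous.
Qed.

Lemma admissible0 : admissible (fun=> 0).
Proof. by split; [exact: cst_continuous|move=> t; rewrite lexx krn_ge0]. Qed.

Lemma admissible_measurable h (D : set R) : admissible h -> measurable_fun D h.
Proof. by case=> /continuous_measurable_fun mh _; exact: measurable_funTS. Qed.

Lemma integrable_admissible (K : R) (g : R -> R) : measurable_fun setT g ->
  (forall s, 0 <= s -> `|g s| <= K * majorant s) ->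
  mu.-integrable `[0, +oo[ (EFin \o g).
Proof.
move=> mg gH.
have := @integrableZl _ _ _ mu _ (measurable_itv `[0, +oo[) K _ int_majorant.
apply: le_integrable => //; first by apply/measurable_EFinP; exact: measurable_funTS.
move=> s; rewrite /= in_itv/= andbT => s0; rewrite lee_fin.
exact: le_trans (gH _ s0) (ler_norm _).
Qed.

Lemma admissible_integrable h : admissible h -> mu.-integrable `[0, +oo[ (EFin \o h).
Proof.
move=> hh; apply: (@integrable_admissible 1); first exact: admissible_measurable.
by move=> s _; have /andP[h0 hH] := hh.2 s; rewrite ger0_norm// mul1r.
Qed.

Lemma norm_krn_admissible x t s h M : 1 < x -> t <= M -> 0 <= s -> admissible h ->
  `|krn x (t - s) * h s| <= krn x M * majorant s.
Proof.
move=> x1 tM s0 hh; have /andP[h0 hH] := hh.2 s.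
rewrite ger0_norm ?mulr_ge0 ?krn_ge0// ler_pM ?krn_ge0//.
by apply: le_krn => //; lra.
Qed.

Lemma measurable_krn_admissible x t h : admissible h ->
  measurable_fun setT (fun s : R => krn x (t - s) * h s).
Proof.
move=> hh; apply: measurable_funM; first exact: measurable_krnB.
exact: admissible_measurable.
Qed.

Lemma krn_admissible_integrable x t h : 1 < x -> admissible h ->
  mu.-integrable `[0, +oo[ (EFin \o (fun s => krn x (t - s) * h s)).
Proof.
move=> x1 hh; apply: (@integrable_admissible (krn x t)).
  exact: measurable_krn_admissible.
by move=> s s0; exact: norm_krn_admissible.
Qed.

Lemma krn_conv_cvg x (t_ : nat -> R) t M (h_ : nat -> R -> R) h :
  1 < x -> (forall n, t_ n <= M) -> t_ @ \oo --> t ->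
  (forall n, admissible (h_ n)) -> (forall s, h_ ^~ s @ \oo --> h s) ->
  \int[mu]_(s in `[0, +oo[) (krn x (t_ n - s) * h_ n s) @[n --> \oo] -->
  \int[mu]_(s in `[0, +oo[) (krn x (t - s) * h s).
Proof.
move=> x1 tM tt ah hh.
have mh : measurable_fun setT h.
  apply: (@measurable_fun_cvg _ _ _ _ h_) => // n.
  exact: admissible_measurable.
have [||||||_ //] := @Rintegral_cvg R `[0, +oo[ (fun n s => krn x (t_ n - s) * h_ n s)
  (fun s => krn x (t - s) * h s) (fun s => krn x M * majorant s).
- exact: measurable_itv.
- by move=> n; apply: measurable_funTS; exact: measurable_krn_admissible.
- apply: measurable_funTS; apply: measurable_funM => //; exact: measurable_krnB.
- apply: aeW => s _; apply: cvgM; last exact: hh.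
  apply: (@cvg_comp _ _ _ (fun n => t_ n - s) (krn x) _ (nbhs (t - s))).
    by apply: cvgB => //; exact: cvg_cst.
  exact: krn_continuous.
- exact: (@integrableZl _ _ _ mu _ (measurable_itv `[0, +oo[) _ _ int_majorant).
- move=> n s; rewrite /= in_itv/= andbT => s0.
  exact: norm_krn_admissible.
Qed.

Lemma Rintegral_admissible_cvg (h_ : nat -> R -> R) h :
  (forall n, admissible (h_ n)) -> (forall s, h_ ^~ s @ \oo --> h s) ->
  \int[mu]_(s in `[0, +oo[) h_ n s @[n --> \oo] --> \int[mu]_(s in `[0, +oo[) h s.
Proof.
move=> ah hh.
have mh : measurable_fun setT h.
  apply: (@measurable_fun_cvg _ _ _ _ h_) => // n.
  exact: admissible_measurable.
have [||||||_ //] := @Rintegral_cvg R `[0, +oo[ h_ h majorant.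
- exact: measurable_itv.
- by move=> n; exact: admissible_measurable.
- exact: measurable_funTS.
- by apply: aeW => s _; exact: hh.
- exact: int_majorant.
- by move=> n s _; have /andP[h0 hH] := (ah n).2 s; rewrite ger0_norm.
Qed.

Lemma velocity_cvg (c_ e_ : nat -> R) c e (h_ : nat -> R -> R) h t :
  c_ @ \oo --> c -> (forall n, 0 <= e_ n) -> e_ @ \oo --> e ->
  (forall n, admissible (h_ n)) -> (forall s, h_ ^~ s @ \oo --> h s) ->
  velocity (c_ n) (e_ n) (h_ n) t @[n --> \oo] --> velocity c e h t.
Proof.
move=> cc e0 ee ah hh; apply: cvgMr; apply: cvgB; first exact: cvgMl.
apply: (@krn_conv_cvg _ (fun n => t - e_ n) _ t) => //.
  by move=> n; rewrite lerBlDr lerDl.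
by apply: cvgB => //; exact: cvg_cst.
Qed.

Definition holder_cst c := (Gamma A)^-1 * (`|c| + \int[mu]_(s in `[0, +oo[) majorant s).

(** The constant involves neither [e] nor [h], only [c] and the integral of the majorant, as
    equicontinuity for vanishing delay requires. *)
Lemma velocity_holder c e h t s : admissible h ->
  `|velocity c e h t - velocity c e h s| <= holder_cst c * `|t - s| `^ (A - 1).
Proof.
move=> hh; have A12 : 1 < A <= 2 by rewrite A_gt1.
rewrite /velocity -mulrBr normrM /holder_cst -mulrA.
have G0 : 0 <= (Gamma A)^-1.
  by rewrite invr_ge0; apply/ltW/Gamma_gt0; rewrite (lt_trans _ A_gt1).
rewrite ger0_norm// ler_wpM2l//.
have aux (k1 k2 i1 i2 : R) : c * k1 - i1 - (c * k2 - i2) = c * (k1 - k2) - (i1 - i2).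
  by ring.
rewrite aux (le_trans (ler_normB _ _))//.
rewrite mulrDl normrM lerD//; first by rewrite ler_wpM2l// krn_holder.
have i1 r := krn_admissible_integrable (r - e) A_gt1 hh.
rewrite -RintegralB//.
have i2 : mu.-integrable `[0, +oo[
    (EFin \o (fun r => krn A (t - e - r) * h r - krn A (s - e - r) * h r)).
  by apply: eq_integrable (integrableB _ (i1 t) (i1 s)).
apply: le_trans (le_normr_Rintegral _ i2) _ => //.
rewrite -RintegralZr//.
apply: le_Rintegral => //; first exact: integrable_norm.
  exact: (@integrableZr _ _ _ mu _ (measurable_itv `[0, +oo[) _ _ int_majorant).
move=> r _; rewrite -mulrBl normrM mulrC ler_pM//.
  by have /andP[h0 hH] := hh.2 r; rewrite ger0_norm.
have := krn_holder (t - e - r) (s - e - r) A12.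
by rewrite (_ : t - e - r - (s - e - r) = t - s); last by ring.
Qed.

Lemma velocity_le0 c e h t : 0 <= e -> t <= 0 -> velocity c e h t = 0.
Proof.
move=> e0 t0; rewrite /velocity.
have -> : krn A t = 0 by rewrite /krn ltNge t0.
rewrite mulr0 sub0r [X in - X](_ : _ = 0) ?oppr0 ?mulr0//.
rewrite /Rintegral integral0_eq// => s; rewrite /= in_itv/= andbT => s0.
by rewrite /krn ifF ?mul0r// ltNge; apply/negbF; lra.
Qed.

Lemma holder_cst_ge0 c : 0 <= holder_cst c.
Proof.
have A0 : 0 < A by rewrite (lt_trans _ A_gt1).
rewrite mulr_ge0 ?invr_ge0 ?(ltW (Gamma_gt0 _))// addr_ge0//.
by apply: Rintegral_ge0 => s _; exact: krn_ge0.
Qed.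

Lemma velocity_continuous c e h : admissible h -> continuous (velocity c e h).
Proof.
move=> hh; apply: (@holder_continuous _ (holder_cst c) (A - 1)).
- by rewrite subr_gt0.
- exact: holder_cst_ge0.
- by move=> t s; exact: velocity_holder.
Qed.

(** Two dominated convergences: [b] dominates on [0, s] for the primitives, and B times the kernel
    times [a] for the fractional integral. *)
Lemma forcing_cvg (v_ : nat -> R -> R) v (b : R -> R) t :
  (forall n, continuous (v_ n)) -> continuous v -> continuous b ->
  (forall n s, `|v_ n s| <= b s) -> (forall s, v_ ^~ s @ \oo --> v s) ->
  forcing (v_ n) t @[n --> \oo] --> forcing v t.
Proof.
move=> cv_ cv cb vb vv.
apply: (@cvg_comp _ _ _ (fun n => RLint gam (source (v_ n)) t) (krn q) _
  (nbhs (RLint gam (source v) t))); last exact: krn_continuous.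
apply: cvgMr.
have [||||||_ //] := @Rintegral_cvg R `[0, t]
  (fun n s => (t - s) `^ (gam - 1) * source (v_ n) s)
  (fun s => (t - s) `^ (gam - 1) * source v s)
  (fun s => B * ((t - s) `^ (gam - 1) * a s)).
- exact: measurable_itv.
- move=> n; apply: measurable_funM; first exact: measurable_powR_subl.
  exact: measurable_source.
- apply: measurable_funM; first exact: measurable_powR_subl.
  exact: measurable_source.
- apply: aeW => s _; apply: cvgMr; apply: cvgMr.
  have uu : antider (v_ n) s @[n --> \oo] --> antider v s.
    have [||||||_ //] := @Rintegral_cvg R `[0, s] v_ v b.
    + exact: measurable_itv.
    + by move=> n; apply: measurable_funTS; exact: continuous_measurable_fun.
    + by apply: measurable_funTS; exact: continuous_measurable_fun.
    + by apply: aeW => r _; exact: vv.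
    + exact: continuous_integrable_itv.
    + by move=> n r _; exact: vb.
  have pc : (s, antider (v_ n) s, v_ n s) @[n --> \oo] --> (s, antider v s, v s).
    exact: (cvg_pair (cvg_pair (cvg_cst s) uu) (vv s)).
  have := cvg_comp _ _ pc (@F_cont (s, antider v s, v s)); exact.
- exact: (@integrableZl _ _ _ mu `[0, t] (measurable_itv _) B _ (RLint_a_exists t)).
- move=> n s; rewrite /= in_itv/= => /andP[s0 _].
  have k0 : 0 <= (t - s) `^ (gam - 1) * a s by rewrite mulr_ge0 ?powR_ge0 ?a_ge0.
  by rewrite /source mulrA normrM (ger0_norm k0) mulrC ler_wpM2r// norm_F.
Qed.

Lemma eq_velocity c e h1 h2 x t : (forall s, s <= x -> h1 s = h2 s) -> t <= x + e ->
  velocity c e h1 t = velocity c e h2 t.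
Proof.
move=> h12 tx; rewrite /velocity; congr (_ * (_ - _)).
apply: eq_Rintegral => s _; have [sx|xs] := leP s x; first by rewrite h12.
by rewrite /krn ifF ?mul0r// ltNge; apply/negbF; lra.
Qed.

Lemma eq_forcing v1 v2 x t : (forall s, s <= x -> v1 s = v2 s) -> t <= x ->
  forcing v1 t = forcing v2 t.
Proof.
move=> v12 tx; rewrite /forcing /RLint; congr (krn q (_ * _)).
apply: eq_Rintegral => s; rewrite inE/= in_itv/= => /andP[_ st].
rewrite /source v12; last exact: le_trans tx.
congr (_ * (_ * F _ _ _)); apply: eq_Rintegral => r.
rewrite inE/= in_itv/= => /andP[_ rs]; apply: v12.
exact: le_trans rs (le_trans st tx).
Qed.

(** * The condition at infinity and the choice of c *)

Variables (be : R) (k : nat) (xi eta : 'I_k -> R).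
Hypotheses (be_gt0 : 0 < be) (xi_gt0 : forall i, 0 < xi i)
  (eta_gt0 : forall i, 0 < eta i).
Definition weight := \sum_(i < k) eta i * xi i `^ (A + be - 1).
Hypothesis weight_lt : weight < Gamma (A + be).

(* [slope h] is the value of the constant [c] for which the boundary condition at
   infinity holds. *)
Definition potential h x :=
  (Gamma (A + be))^-1 * \int[mu]_(s in `[0, +oo[) (krn (A + be) (x - s) * h s).

Definition slope h :=
  (\int[mu]_(s in `[0, +oo[) h s - \sum_(i < k) eta i * potential h (xi i)) /
  (1 - weight / Gamma (A + be)).

(** [slope] with the majorant in place of [h] and the subtracted sum dropped; it equals M Gamma
    (alpha - 1) for the M of the statement. *)
Definition slope_max :=
  (\int[mu]_(s in `[0, +oo[) majorant s) / (1 - weight / Gamma (A + be)).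

Let Abe_gt1 : 1 < A + be. Proof. by rewrite (lt_trans A_gt1)// ltrDl. Qed.

Let GAbe_gt0 : 0 < Gamma (A + be).
Proof. by apply: Gamma_gt0; rewrite (lt_trans _ Abe_gt1). Qed.

Let denom_gt0 : 0 < 1 - weight / Gamma (A + be).
Proof. by rewrite subr_gt0 ltr_pdivrMr// mul1r. Qed.

Lemma slope_cvg (h_ : nat -> R -> R) h :
  (forall n, admissible (h_ n)) -> (forall s, h_ ^~ s @ \oo --> h s) ->
  slope (h_ n) @[n --> \oo] --> slope h.
Proof.
move=> ah hh; apply: cvgMl; apply: cvgB; first exact: Rintegral_admissible_cvg.
elim: (index_enum _) => [|i r ih].
  by under eq_cvg do rewrite big_nil; rewrite big_nil; exact: cvg_cst.
under eq_cvg do rewrite big_cons.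
rewrite big_cons; apply: cvgD; last exact: ih.
apply: cvgMr; apply: cvgMr.
exact: (@krn_conv_cvg _ (fun=> xi i) _ (xi i) _ _ Abe_gt1 (fun=> lexx _)
  (cvg_cst _) ah hh).
Qed.

Lemma potential_ge0 h x : admissible h -> 0 <= potential h x.
Proof.
move=> hh; rewrite mulr_ge0 ?invr_ge0 ?(ltW GAbe_gt0)//.
apply: Rintegral_ge0 => s _; rewrite mulr_ge0 ?krn_ge0//.
by have /andP[] := hh.2 s.
Qed.

Lemma potential_le h x : admissible h -> 0 < x ->
  potential h x <= x `^ (A + be - 1) / Gamma (A + be) *
    \int[mu]_(s in `[0, +oo[) h s.
Proof.
move=> hh x0; rewrite /potential [leRHS]mulrAC [leRHS]mulrC.
rewrite ler_wpM2l ?invr_ge0 ?(ltW GAbe_gt0)//.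
have ih := admissible_integrable hh.
rewrite -RintegralZl//; apply: le_Rintegral => //.
- exact: krn_admissible_integrable.
- exact: (@integrableZl _ _ _ mu _ (measurable_itv `[0, +oo[) _ _ ih).
- move=> s; rewrite /= in_itv/= andbT => s0.
  have -> : x `^ (A + be - 1) = krn (A + be) x by rewrite /krn x0.
  rewrite ler_wpM2r//; first by have /andP[] := hh.2 s.
  by apply: le_krn => //; lra.
Qed.

Lemma Rintegral_admissible_ge0 h : admissible h ->
  0 <= \int[mu]_(s in `[0, +oo[) h s.
Proof. by move=> hh; apply: Rintegral_ge0 => s _; have /andP[] := hh.2 s. Qed.

(** By [potential_le] the subtracted sum is at most [weight / Gamma (A + be)] times the integral of
    [h], which is exactly what the denominator compensates. This bound is what later makes u and u'
    nonnegative. *)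
Lemma slope_ge h : admissible h -> \int[mu]_(s in `[0, +oo[) h s <= slope h.
Proof.
move=> hh; rewrite ler_pdivlMr// mulrBr mulr1 lerD2l lerN2.
rewrite /weight mulr_suml mulr_sumr; apply: ler_sum => i _.
have := potential_le hh (xi_gt0 i).
move=> /(ler_wpM2l (ltW (eta_gt0 i)))/le_trans; apply.
by rewrite le_eqVlt; apply/orP; left; apply/eqP; ring.
Qed.

Lemma slope_le h : admissible h -> slope h <= slope_max.
Proof.
move=> hh; rewrite ler_pM2r ?invr_gt0//.
apply: (@le_trans _ _ (\int[mu]_(s in `[0, +oo[) h s)).
  rewrite gerBl sumr_ge0// => i _.
  by rewrite mulr_ge0 ?(ltW (eta_gt0 i))// potential_ge0.
apply: le_Rintegral => //; first exact: admissible_integrable.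
by move=> s _; have /andP[] := hh.2 s.
Qed.

(* By causality [approx c e N] is an exact fixed point on [(-oo, N e]]. *)
Definition approx c e N := iter N (fun h => forcing (velocity c e h)) (fun=> 0).

Lemma approx_admissible c e N : admissible (approx c e N).
Proof.
elim: N => [|N ih]; first exact: admissible0.
by apply: forcing_admissible; exact: velocity_continuous.
Qed.

(** The Hoelder bound from the value 0 at 0, weakened to a continuous function of [s] uniform in c:
    the dominating [b] of [forcing_cvg]. *)
Lemma norm_velocity_le c e h (M : R) s : 0 <= e -> admissible h -> `|c| <= M ->
  `|velocity c e h s| <= holder_cst M * (1 + `|s|).
Proof.
move=> e0 hh cM.
have G0 : 0 <= (Gamma A)^-1.
  by rewrite invr_ge0; apply/ltW/Gamma_gt0; rewrite (lt_trans _ A_gt1).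
have := velocity_holder c e s 0 hh; rewrite (velocity_le0 _ _ e0 (lexx 0)) !subr0.
move=> /le_trans; apply; rewrite ler_pM ?powR_ge0 ?holder_cst_ge0//.
  by rewrite ler_wpM2l// lerD2r (le_trans cM)// ler_norm.
have A1 : 0 <= A - 1 by rewrite subr_ge0 ltW.
have [s1|s1] := leP `|s| 1.
  have : `|s| `^ (A - 1) <= 1 `^ (A - 1) by apply: ge0_ler_powR; rewrite ?nnegrE.
  by rewrite powR1 => /le_trans; apply; rewrite lerDl.
rewrite (@le_trans _ _ `|s|) ?lerDr//; apply: ler1_powR; first exact: ltW.
by rewrite lerBlDr.
Qed.

Lemma approx_cvg (c_ : nat -> R) c e N t : 0 <= e -> c_ @ \oo --> c ->
  approx (c_ n) e N t @[n --> \oo] --> approx c e N t.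
Proof.
move=> e0 cc.
have [M cM] : exists M, forall n, `|c_ n| <= M.
  have [M [_ hM]] := cvg_seq_bounded (cvgP _ cc).
  by exists (M + 1) => n; apply: (hM (M + 1)) => //; rewrite ltrDl.
elim: N t => [|N ih] t; first exact: cvg_cst.
apply: (@forcing_cvg (fun n => velocity (c_ n) e (approx (c_ n) e N)) _
  (fun s => holder_cst M * (1 + `|s|))).
- by move=> n; apply: velocity_continuous; exact: approx_admissible.
- by apply: velocity_continuous; exact: approx_admissible.
- move=> s; apply: cvgMr; apply: cvgD; first exact: cvg_cst.
  exact: norm_continuous.
- by move=> n s; exact: (norm_velocity_le s e0 (approx_admissible _ _ _) (cM n)).
- move=> s; exact: (@velocity_cvg c_ (fun=> e) c e (fun n => approx (c_ n) e N) _ s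
    cc (fun=> e0) (cvg_cst e) (fun n => approx_admissible _ _ _) ih).
Qed.

Lemma approx_fix c e N t : t <= N%:R * e ->
  approx c e N t = forcing (velocity c e (approx c e N)) t.
Proof.
rewrite -[RHS]/(approx c e N.+1 t); elim: N t => [|N ih] t tN.
  rewrite mul0r in tN.
  by rewrite /approx/= /forcing RLint_le0// /krn ltxx.
apply: (@eq_forcing _ _ (N.+1%:R * e)) => // s sN.
apply: (@eq_velocity _ _ _ _ (N%:R * e)).
  by move=> r rN; exact: ih.
by rewrite -natr1 mulrDl mul1r in sN.
Qed.

(* Intermediate values for [c |-> slope (approx c e N) - c], as
   [0 <= slope <= slope_max] whatever [c]. *)
Lemma shooting e N : 0 <= e ->
  exists2 c, 0 <= c <= slope_max & slope (approx c e N) = c.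
Proof.
move=> e0.
have aN c := approx_admissible c e N.
have smax0 : 0 <= slope_max.
  apply: le_trans (slope_le (aN 0)); apply: le_trans (slope_ge (aN 0)).
  exact: Rintegral_admissible_ge0.
pose f c := slope (approx c e N) - c.
have cf : continuous f.
  move=> c; apply/(@cvg_nbhsP _ R^o) => u uc; apply: cvgB => //.
  by apply: slope_cvg => // s; exact: approx_cvg.
have f0 : 0 <= f 0.
  rewrite /f subr0; apply: le_trans (slope_ge (aN 0)).
  exact: Rintegral_admissible_ge0.
have fm : f slope_max <= 0 by rewrite subr_le0 slope_le.
have [||c] := @IVT _ f 0 slope_max 0 smax0.
- exact: continuous_subspaceT.
- by rewrite ge_min fm orbT/= le_max f0.
by rewrite in_itv/= => cm /eqP; rewrite subr_eq0 => /eqP fc; exists c.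
Qed.

Theorem existence : exists c v,
  [/\ 0 <= c <= slope_max, continuous v, c = slope (forcing v) &
      forall t, v t = velocity c 0 (forcing v) t].
Proof.
pose e_ n : R := n.+1%:R^-1.
have e0 n : 0 <= e_ n by rewrite invr_ge0.
have /choice[c_ hc] : forall n, exists c, 0 <= c <= slope_max /\
    slope (approx c (e_ n) (n * n.+1)) = c.
  by move=> n; have [c] := shooting (n * n.+1) (e0 n); exists c.
(* With delay 1/(n+1), n(n+1) iterations make the fixed point exact up to time n, so every [t] is
   eventually covered. *)
pose h_ n := approx (c_ n) (e_ n) (n * n.+1).
pose v_ n := velocity (c_ n) (e_ n) (h_ n).
have ah n : admissible (h_ n) by exact: approx_admissible.
have cM n : `|c_ n| <= slope_max.
  by have [/andP[c0 cm] _] := hc n; rewrite ger0_norm.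
have G0 : 0 <= (Gamma A)^-1.
  by rewrite invr_ge0; apply/ltW/Gamma_gt0; rewrite (lt_trans _ A_gt1).
have vK n t s : `|v_ n t - v_ n s| <= holder_cst slope_max * `|t - s| `^ (A - 1).
  apply: le_trans (velocity_holder _ _ _ _ (ah n)) _.
  rewrite ler_wpM2r ?powR_ge0// ler_wpM2l// lerD2r.
  by rewrite (le_trans (cM n))// ler_norm.
have A1 : 0 < A - 1 by rewrite subr_gt0.
have [|nu [v [nuk vH vv]]] := @holder_compact _ _ _ v_ A1 (holder_cst_ge0 slope_max) vK.
  by move=> n; exact: velocity_le0.
have cv : continuous v by exact: holder_continuous A1 (holder_cst_ge0 _) vH.
have hh t : h_ (nu j) t @[j --> \oo] --> forcing v t.
  have := @forcing_cvg (fun j => v_ (nu j)) v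
    (fun s => holder_cst slope_max * (1 + `|s|)) t.
  move=> /(_ _ cv _ _ vv) h.
  have : forcing (v_ (nu j)) t @[j --> \oo] --> forcing v t.
    apply: h.
    - by move=> j; exact: velocity_continuous.
    - move=> s; apply: cvgMr; apply: cvgD; first exact: cvg_cst.
      exact: norm_continuous.
    - by move=> j s; exact: (norm_velocity_le s (e0 _) (ah _) (cM _)).
  apply: cvg_trans; apply: near_eq_cvg.
  exists (Num.truncn t).+1 => // j /= tj; rewrite /v_ /h_.
  symmetry; apply: approx_fix.
  rewrite natrM -mulrA mulfV ?mulr1// ltW//.
  by rewrite (lt_le_trans (truncnS_gt _))// ler_nat (leq_trans tj).
(* The constants need no further extraction: each is the slope of its own [h_ n], and the slopes
   converge with these. *)
have cc : c_ (nu j) @[j --> \oo] --> slope (forcing v).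
  have := @slope_cvg (fun j => h_ (nu j)) _ (fun j => ah _) hh.
  by under eq_cvg do rewrite (hc (nu _)).2.
have ec : e_ (nu j) @[j --> \oo] --> 0.
  apply: (@squeeze_cvgr _ _ _ _ (cst 0) (fun j => j.+1%:R^-1)).
  - apply: nearW => j; rewrite e0/= lef_pV2 ?posrE// ler_nat ltnS.
    exact: nuk.
  - exact: cvg_cst.
  - exact: cvg_harmonic.
have vE t : v t = velocity (slope (forcing v)) 0 (forcing v) t.
  apply: (cvg_unique _ (vv t)) => //.
  exact: (@velocity_cvg (fun j => c_ (nu j)) (fun j => e_ (nu j)) _ _
    (fun j => h_ (nu j)) _ t cc (fun j => e0 _) ec (fun j => ah _) hh).
have av := forcing_admissible cv.
exists (slope (forcing v)), v; split => //.
rewrite slope_le// andbT (le_trans _ (slope_ge av))//.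
exact: Rintegral_admissible_ge0.
Qed.

(** * From the fixed point to a positive solution *)

Section FixedPoint.
Variables (c : R) (v : R -> R).
Hypotheses (v_cont : continuous v) (c_ge0 : 0 <= c) (c_slope : c = slope (forcing v))
  (v_fix : forall t, v t = velocity c 0 (forcing v) t).

Local Notation h := (forcing v).
Local Notation u := (antider v).

Let h_adm : admissible h. Proof. exact: forcing_admissible. Qed.

Let h_ge0 t : 0 <= h t. Proof. by have /andP[] := h_adm.2 t. Qed.

Let A_gt0 : 0 < A. Proof. exact: lt_trans A_gt1. Qed.

Lemma velocity_profile t : 0 <= t -> v t = profile c h A t.
Proof.
move=> t0; rewrite v_fix /velocity krnE// /profile subr0.
have eh : RLint_exists A h t by apply: continuous_RLint_exists => //; exact: h_adm.1.
by rewrite (RLint_krn eh).2 mulrBr mulrA [_^-1 * c]mulrC.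
Qed.

Lemma antider_profile t : 0 <= t -> u t = profile c h (A + 1) t.
Proof.
move=> t0; have [||] := @RLint_profile R c h h_adm.1 h_ge0 1 A t ltr01 A_gt0.
- by rewrite ltrDl.
- exact: t0.
move=> _; rewrite addrC => <-; rewrite RLint1.
apply: eq_Rintegral => s; rewrite inE/= in_itv/= => /andP[s0 _].
exact: velocity_profile.
Qed.

Lemma Rintegral_forcing_le : \int[mu]_(s in `[0, +oo[) h s <= c.
Proof. by rewrite [leRHS]c_slope; exact: slope_ge. Qed.

(** For s >= 0 the kernel at t - s is at most the kernel at t, and the integral of [h] is at most
    c. *)
Lemma RLint_forcing_le x t : 1 < x -> 0 <= t -> RLint x h t <= c / Gamma x * t `^ (x - 1).
Proof.
move=> x1 t0; have x0 : 0 < x by apply: lt_trans x1.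
have eh : RLint_exists x h t by apply: continuous_RLint_exists => //; exact: h_adm.1.
rewrite (RLint_krn eh).2 -mulrA mulrCA ler_wpM2l ?invr_ge0 ?(ltW (Gamma_gt0 x0))//.
apply: (@le_trans _ _ (krn x t * \int[mu]_(s in `[0, +oo[) h s)); last first.
  by rewrite mulrC krnE// ler_wpM2r ?powR_ge0// Rintegral_forcing_le.
have ih := admissible_integrable h_adm.
rewrite -(@RintegralZl _ _ _ mu `[0, +oo[ h _ (measurable_itv _) ih).
apply: le_Rintegral; first exact: measurable_itv.
- exact: krn_admissible_integrable.
- exact: (@integrableZl _ _ _ mu _ (measurable_itv `[0, +oo[) _ _ ih).
- move=> s; rewrite /= in_itv/= andbT => s0; rewrite ler_wpM2r// le_krn//.
  by rewrite gerBl.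
Qed.

Lemma profile_bounds x t : 1 < x -> 0 <= t ->
  0 <= profile c h x t <= c / Gamma x * t `^ (x - 1).
Proof.
move=> x1 t0; rewrite /profile subr_ge0 RLint_forcing_le//= gerBl.
by apply: RLint_ge0 => //; exact: lt_trans x1.
Qed.

Lemma is_hderive_antider t : 0 <= t -> is_hderive u t (v t).
Proof.
move=> t0; apply: FTC_half_line => //; last exact/continuous_hcont/v_cont.
by move=> x; exact: continuous_integrable_itv.
Qed.

Lemma hderive_antider t : 0 <= t -> hderivable u t /\ hderive u t = v t.
Proof. by move=> t0; apply: is_hderiveP => //; exact: is_hderive_antider. Qed.

Lemma RLint_hderive_antider t : 0 <= t ->
  RLint_exists be (hderive u) t /\ RLint be (hderive u) t = profile c h (A + be) t.
Proof.
move=> t0; have Abe : 1 < be + A by rewrite addrC; exact: Abe_gt1.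
have [e1 e2] := RLint_profile c h_adm.1 h_ge0 be_gt0 A_gt0 Abe t0.
have e s : 0 <= s <= t -> profile c h A s = hderive u s.
  by move=> /andP[s0 _]; rewrite -velocity_profile// (hderive_antider s0).2.
split; first exact: (eq_RLint_exists e e1).
by rewrite addrC; exact: etrans (esym (eq_RLint be e)) e2.
Qed.

Lemma cvg_Rintegral_pinfty :
  \int[mu]_(s in `[0, t]) h s @[t --> +oo] --> \int[mu]_(s in `[0, +oo[) h s.
Proof.
apply/cvg_pinftyP => w ww.
have ih := admissible_integrable h_adm.
have mh (D : set R) : measurable_fun D h by exact: admissible_measurable.
have [||||||_] := @Rintegral_cvg R `[0, +oo[ (fun n => h \_ `[0, w n]) h h.
- exact: measurable_itv.
- move=> n; apply: measurable_funTS.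
  have m1 : measurable_fun (setT : set R) (h \_ `[0, w n]).
    by apply/(measurable_restrictT _ _).1; [exact: measurable_itv|exact: mh].
  exact: m1.
- exact: mh.
- apply: aeW => s; rewrite /= in_itv/= andbT => s0.
  apply: cvg_near_cst.
  have : \forall n \near \oo, s <= w n by exact: (cvgryPge _).1 ww s.
  by apply: filterS => n sn; rewrite patchE mem_setE in_itv/= s0 sn.
- exact: ih.
- move=> n s _; rewrite patchE; case: ifP => _; last by rewrite normr0.
  by rewrite ger0_norm.
apply: cvg_trans; apply: near_eq_cvg; apply: nearW => n.
rewrite Rintegral_mkcond [RHS]Rintegral_mkcond; apply: eq_Rintegral => s _.
rewrite !patchE !mem_setE !in_itv/= andbT.
by case: (leP 0 s).
Qed.

Lemma slope_eq : c * (1 - weight / Gamma (A + be)) =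
  \int[mu]_(s in `[0, +oo[) h s - \sum_(i < k) eta i * potential h (xi i).
Proof. by rewrite {1}c_slope divfK// lt0r_neq0// denom_gt0. Qed.

(** The left side is the limit of [profile 1], that is of D^(alpha-1) u. Expanding the right side
    with [profile (A + be)] leaves the equation that defines [slope]. *)
Lemma boundary_value :
  c - \int[mu]_(s in `[0, +oo[) h s = \sum_(i < k) eta i * RLint be (hderive u) (xi i).
Proof.
have E i : RLint be (hderive u) (xi i) =
    c / Gamma (A + be) * xi i `^ (A + be - 1) - potential h (xi i).
  rewrite (RLint_hderive_antider (ltW (xi_gt0 i))).2 /profile; congr (_ - _).
  have eh : RLint_exists (A + be) h (xi i).
    apply: continuous_RLint_exists => //; last exact: h_adm.1.
    by rewrite addr_gt0.
  by rewrite (RLint_krn eh).2.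
under eq_bigr do rewrite E mulrBr.
rewrite sumrB.
have -> : \sum_(i < k) eta i * (c / Gamma (A + be) * xi i `^ (A + be - 1)) =
    c * (weight / Gamma (A + be)).
  rewrite /weight mulr_suml mulr_sumr; apply: eq_bigr => i _; ring.
have := slope_eq; set P := \sum_i eta i * _; set I := Rintegral _ _ _.
rewrite mulrBr mulr1; move: (c * _) => x; lra.
Qed.

(** If [h] vanished, so would c, u and u', and the source would be a F(., 0, 0), which is excluded;
    so [h] has positive integral. A zero of u at t > 0 would be an equality case of the kernel
    inequality in [RLint_forcing_le], which is strict for every s > 0 and so would force h = 0. *)
Lemma antider_gt0 :
  ~ (forall t, 0 <= t -> RLint gam (fun s => a s * F s 0 0) t = 0) ->
  forall t, 0 < t -> 0 < u t.
Proof.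
move=> nz t t0.
have ih := admissible_integrable h_adm.
have Ipos : 0 < \int[mu]_(s in `[0, +oo[) h s.
  rewrite ltNge; apply/negP => I0; apply: nz => r r0.
  have h0 := integral_eq0_continuous h_adm.1 (fun t _ => h_ge0 t) ih I0.
  have c0 : c = 0.
    apply/eqP; rewrite eq_le c_ge0 andbT -(pmulr_lle0 _ denom_gt0) slope_eq.
    rewrite subr_le0 (le_trans I0)// sumr_ge0// => i _.
    by rewrite mulr_ge0 ?(ltW (eta_gt0 i))// potential_ge0.
  have v0 s : 0 <= s -> v s = 0.
    move=> s0; rewrite velocity_profile// /profile c0 !mul0r sub0r.
    rewrite (@eq_RLint _ A h (fun s => 0 * h s)).
      by rewrite RLintZ ?mul0r ?oppr0//; apply: continuous_RLint_exists => //; exact: h_adm.1.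
    by move=> y /andP[y0 _]; rewrite h0// mulr0.
  have u0 s : 0 <= s -> u s = 0.
    move=> s0; rewrite /antider /Rintegral integral0_eq// => y.
    by rewrite /= in_itv/= => /andP[/v0 ->].
  have := h0 r r0; rewrite /forcing /krn.
  have e : RLint gam (source v) r = RLint gam (fun s => a s * F s 0 0) r.
    by apply: eq_RLint => s /andP[s0 _]; rewrite /source u0// v0.
  case: ifP => [r1 /eqP|/negbT].
    by rewrite powR_eq0 -e => /andP[/eqP ->].
  by rewrite -leNgt e => r1 _; apply/eqP; rewrite -e eq_le e r1 -e RLint_source_ge0.
have A1 : 1 < A + 1 by rewrite ltrDr.
have /andP[P0 _] := profile_bounds A1 (ltW t0).
rewrite antider_profile ?(ltW t0)// lt_neqAle P0 andbT eq_sym; apply/eqP => Pz.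
pose g s := (krn (A + 1) t - krn (A + 1) (t - s)) * h s.
have i1 := @krn_admissible_integrable (A + 1) t h A1 h_adm.
have i2 : mu.-integrable `[0, +oo[ (EFin \o (fun s => krn (A + 1) t * h s)).
  exact: (@integrableZl _ _ _ mu _ (measurable_itv `[0, +oo[) _ _ ih).
have ig : mu.-integrable `[0, +oo[ (EFin \o g).
  apply: eq_integrable (integrableB _ i2 i1) => // s _ /=.
  by rewrite -EFinB /g mulrBl.
have cg : continuous g.
  move=> s; apply: cvgM; last exact: h_adm.1.
  apply: cvgB; first exact: cvg_cst.
  apply: (@cvg_comp _ _ _ (fun r => t - r) (krn (A + 1)) _ (nbhs (t - s))).
    by apply: cvgB; [exact: cvg_cst|exact: cvg_id].
  exact: krn_continuous.
have g0 s : 0 <= s -> 0 <= g s.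
  by move=> s0; rewrite mulr_ge0// subr_ge0 le_krn// gerBl.
have Ig : \int[mu]_(s in `[0, +oo[) g s <= 0.
  have -> : \int[mu]_(s in `[0, +oo[) g s = krn (A + 1) t * \int[mu]_(s in `[0, +oo[) h s
      - \int[mu]_(s in `[0, +oo[) (krn (A + 1) (t - s) * h s).
    rewrite -RintegralZl// -RintegralB//.
    by apply: eq_Rintegral => s _; rewrite /g mulrBl.
  have G0 : 0 < Gamma (A + 1) by apply: Gamma_gt0; rewrite addr_gt0.
  have eh : RLint_exists (A + 1) h t.
    by apply: continuous_RLint_exists; [rewrite addr_gt0|exact: h_adm.1].
  move: Pz; rewrite /profile (RLint_krn eh).2 mulrAC [c * _ / _]mulrC -mulrBr => /eqP.
  rewrite mulf_eq0 invr_eq0 gt_eqF//= subr_eq0 => /eqP <-.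
  rewrite -krnE ?(ltW t0)// subr_le0 mulrC ler_wpM2r ?krn_ge0//.
  exact: Rintegral_forcing_le.
have gz := integral_eq0_continuous cg g0 ig Ig.
have hz s : 0 < s -> h s = 0.
  move=> s0; have /eqP := gz s (ltW s0); rewrite /g mulf_eq0 => /orP[|/eqP//].
  rewrite subr_eq0 gt_eqF// {2}/krn t0 /krn; case: ifP => [ts|_]; last exact: powR_gt0.
  rewrite addrK; apply: gt0_ltr_powR => //; rewrite ?nnegrE ?ltW//.
  by rewrite ltrBlDr ltrDl.
have : \int[mu]_(s in `[0, +oo[) h s = 0.
  rewrite -(@Rintegral_itv_obnd_cbnd _ 0 _ h).
    by rewrite /Rintegral integral0_eq// => s; rewrite /= in_itv/= andbT => /hz ->.
  apply: integrableS ih => // s /=; rewrite !in_itv/= !andbT; exact: ltW.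
by move=> I0; rewrite I0 ltxx in Ipos.
Qed.

Hypothesis gam_le1 : gam <= 1.

Lemma source_integrable x : mu.-integrable `[0, x] (EFin \o source v).
Proof.
apply/RLint_exists1; apply: (RLint_exists_le gam_gt0 gam_le1); last exact: source_RLint.
exact: measurable_source.
Qed.

Variables (p : R) (f : R -> R -> R -> R).
Hypotheses (pq : (p - 1) * (q - 1) = 1).
Hypothesis F_f : forall t, 0 <= t -> F t (u t) (v t) = f t (u t) (v t).

(** [phi p] is odd and, as (p - 1)(q - 1) = 1, inverts [krn q] on nonnegative numbers. *)
Lemma phi_forcing t : phi p (- h t) = - RLint gam (source v) t.
Proof.
have := RLint_source_ge0 v t; rewrite /forcing; move: (RLint _ _ _) => y.
rewrite le_eqVlt => /predU1P[<-|y0].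
  by rewrite (_ : krn q 0 = 0) ?oppr0 /phi ?mulr0// /krn ltxx.
rewrite /krn y0 /phi normrN mulrN; congr (- _).
have yq : 0 < y `^ (q - 1) by exact: powR_gt0.
rewrite gtr0_norm// -{2}(powRr1 (ltW yq)) -powRD; last by rewrite (gt_eqF yq) implybT.
have -> : p - 2 + 1 = p - 1 by ring.
by rewrite -powRrM mulrC pq powRr1// ltW.
Qed.

Lemma RLderive_antider t : 0 <= t ->
  (RLderive_exists (A + 1) u t /\ RLderive (A + 1) u t = - h t) /\
  (RLderive_exists (A + 1 - 1) u t /\ RLderive (A + 1 - 1) u t = profile c h 1 t).
Proof.
move=> t0; apply: (RLderive_profile h_adm.1 h_ge0) => //.
  by rewrite ltrDr.
exact: antider_profile.
Qed.

(** The assumption on the primitive holds almost everywhere by Lebesgue differentiation, and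
    wherever [a] is continuous by the classical theorem: the two clauses of [is_solution]. *)
Lemma equation_antider t : 0 <= t ->
  is_hderive (fun y => \int[mu]_(s in `[0, y]) source v s) t (source v t) ->
  equation_at p gam (A + 1) a f u t.
Proof.
move=> t0 dt; have gam01 : 0 < gam <= 1 by rewrite gam_gt0.
have [] := @RLderive_RLint R gam (source v) (fun s => phi p (RLderive (A + 1) u s)) t gam01 t0.
- by move=> x; exact: measurable_source.
- exact: source_ge0.
- by move=> x _; exact: source_RLint.
- by move=> s s0; rewrite (RLderive_antider s0).1.2 phi_forcing.
- exact: dt.
move=> e1 e2; split => //; rewrite e2 (hderive_antider t0).2 -F_f//.
by rewrite /source addNr.
Qed.

Theorem is_solution_antider : is_solution p gam (A + 1) be xi eta a f u.
Proof.
split.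
- move=> t t0; have [[e1 _] [e2 _]] := RLderive_antider t0; split => //.
  exact: (hderive_antider t0).1.
- split.
    have FF : Filter (almost_everywhere mu) := ae_filter_ringOfSetsType mu.
    apply: filterS (ae_FTC_half_line source_integrable) => t + t0 => /(_ t0).
    exact: equation_antider.
  move=> t t0 ca; apply: equation_antider => //.
  apply: FTC_half_line => //; first exact: source_integrable.
  apply: cvgM; first exact: ca.
  apply: cvg_within_filter; apply: continuous_F3 => //.
  exact: continuous_antider.
- split; first by rewrite antider_le0.
  by rewrite (hderive_antider (lexx _)).2 v_fix velocity_le0.
- split; first by move=> i; exact: (RLint_hderive_antider (ltW (xi_gt0 i))).1.
  rewrite -boundary_value.
  have : profile c h 1 t @[t --> +oo] --> c - \int[mu]_(s in `[0, +oo[) h s.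
    rewrite (_ : profile c h 1 = fun t => c - \int[mu]_(s in `[0, t]) h s); last first.
      by apply/funext => t; rewrite profile1.
    by apply: cvgB; [exact: cvg_cst|exact: cvg_Rintegral_pinfty].
  apply: cvg_trans; apply: near_eq_cvg.
  have : \forall t \near +oo, (0 : R) <= t by exact: nbhs_pinfty_ge.
  by apply: filterS => t t0; rewrite (RLderive_antider t0).2.2.
- by rewrite (RLderive_antider (lexx _)).1.2 /forcing RLint_le0// /krn ltxx oppr0.
Qed.

End FixedPoint.

End Operator.

(** * The boundary value problem *)

Section Auxiliary.
Context {R : realType}.
Implicit Types q x y : R.

Lemma phiE q x : 1 < q -> 0 <= x -> phi q x = krn q x.
Proof.
move=> q1; rewrite /krn /phi le_eqVlt => /predU1P[<-|x0].
  by rewrite mulr0 ltxx.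
rewrite x0 gtr0_norm// -{2}(powRr1 (ltW x0)) -powRD; last by rewrite (gt_eqF x0) implybT.
by congr (_ `^ _); ring.
Qed.

Lemma krnM q x y : 0 <= x -> 0 <= y -> krn q (x * y) = krn q x * krn q y.
Proof.
rewrite le_eqVlt => /predU1P[<- _|x0]; first by rewrite mul0r /krn ltxx mul0r.
rewrite le_eqVlt => /predU1P[<-|y0]; first by rewrite mulr0 /krn ltxx mulr0.
by rewrite /krn x0 y0 mulr_gt0// powRM// ltW.
Qed.

(** Needed because u' is controlled by t^(alpha-2) but measured against 1 + t^(alpha-1). *)
Lemma powRB1_le x y : 1 < x -> 0 <= y -> y `^ (x - 1) <= 1 + y `^ x.
Proof.
move=> x1 y0; have [y1|y1] := leP y 1.
  have : y `^ (x - 1) <= 1 `^ (x - 1).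
    by apply: ge0_ler_powR; rewrite ?nnegrE ?subr_ge0 ?(ltW x1).
  by rewrite powR1 => /le_trans; apply; rewrite lerDl powR_ge0.
rewrite (@le_trans _ _ (y `^ x)) ?lerDr//; apply: ler_powR; first exact: ltW.
by rewrite gerBl.
Qed.

Lemma slope_max_divE (n g A b w j : R) : 0 < n -> 0 < g -> 0 < A -> w < g ->
  g / (A * n * (g - w)) * A * b * j = b * j / (1 - w / g) / n.
Proof.
move=> n0 g0 A0 wg; have d0 : g - w != 0 by rewrite subr_eq0 gt_eqF.
by field; rewrite d0 !lt0r_neq0.
Qed.

End Auxiliary.

(** * Truncation of the nonlinearity *)

Section Truncation.
Context {R : realType}.
Variables (alpha delta : R) (f : R -> R -> R -> R).
Hypotheses (alpha_gt1 : 1 < alpha) (delta_gt0 : 0 < delta).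
Hypothesis f_ge0 : forall t x y : R, 0 <= t -> 0 <= x -> 0 <= y -> 0 <= f t x y.
Hypothesis f_cont : {within [set z : R * R * R |
                        [/\ 0 <= z.1.1, 0 <= z.1.2 & 0 <= z.2]],
              continuous (fun z : R * R * R => f z.1.1 z.1.2 z.2)}.
Hypothesis f_bnd : forall K : R, exists C : R, forall t u v : R,
     0 <= t -> 0 <= u <= K -> 0 <= v <= K ->
     f t ((1 + t `^ (alpha - 1)) * u) ((1 + t `^ (alpha - 1)) * v) <= C.

(* The truncated nonlinearity is continuous on the whole space with values in
   [[0, Bsup]]; the solution found for it stays below [ceiling], where the
   truncation is the identity. *)
Definition ceiling (t : R) := (1 + krn alpha t) * delta.
Definition clip (t x : R) := Num.min (Num.max 0 x) (ceiling t).
Definition truncated t x y := f (Num.max 0 t) (clip t x) (clip t y).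

Lemma ceiling_ge0 t : 0 <= ceiling t.
Proof. by rewrite mulr_ge0 ?addr_ge0 ?krn_ge0// ltW. Qed.

Lemma clip_itv t x : 0 <= clip t x <= ceiling t.
Proof. by rewrite /clip le_min ceiling_ge0 le_max lexx/= ge_min lexx orbT. Qed.

Lemma clip_id t x : 0 <= x <= ceiling t -> clip t x = x.
Proof. by move=> /andP[x0 xt]; rewrite /clip max_r// min_l. Qed.

Lemma truncatedE t x y : 0 <= t -> 0 <= x <= ceiling t -> 0 <= y <= ceiling t ->
  truncated t x y = f t x y.
Proof. by move=> t0 xt yt; rewrite /truncated !clip_id// max_r. Qed.

(** Division by 1 + t^(alpha-1) brings the clipped arguments into [0, delta], so the value is one of
    those under the supremum; [f_bnd] makes that supremum an upper bound. *)
Lemma truncated_itv t x y : 0 <= truncated t x y <= Bsup alpha f delta.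
Proof.
have t0 : 0 <= Num.max 0 t by rewrite le_max lexx.
have /andP[x0 xt] := clip_itv t x; have /andP[y0 yt] := clip_itv t y.
rewrite /truncated f_ge0//=; set r := Num.max 0 t in t0 *.
have K0 : 0 < 1 + krn alpha t by rewrite ltr_wpDr ?krn_ge0.
have rK : 1 + r `^ (alpha - 1) = 1 + krn alpha t.
  congr (1 + _); rewrite /r /krn; case: (ltP 0 t) => t0' //.
  by rewrite powR0// subr_eq0 gt_eqF.
have inr z : 0 <= z -> z <= ceiling t -> 0 <= z / (1 + krn alpha t) <= delta.
  by move=> z0 zt; rewrite divr_ge0 ?(ltW K0)//= ler_pdivrMr// mulrC.
apply: sup_ubound.
  have [C hC] := f_bnd delta; exists C => _ [s [u [v [s0 us vs ->]]]].
  exact: hC.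
exists r, (clip t x / (1 + krn alpha t)), (clip t y / (1 + krn alpha t)).
split => //; [exact: inr|exact: inr|].
by rewrite rK ![(1 + _) * _]mulrC !divfK ?lt0r_neq0.
Qed.

Lemma continuous_truncated :
  continuous (fun z : R * R * R => truncated z.1.1 z.1.2 z.2).
Proof.
have c1 : continuous (fun z : R * R * R => z.1.1).
  by move=> z; exact: (cvg_comp _ _ cvg_fst cvg_fst).
have c2 : continuous (fun z : R * R * R => z.1.2).
  by move=> z; exact: (cvg_comp _ _ cvg_fst cvg_snd).
have c3 : continuous (fun z : R * R * R => z.2).
  by move=> z; exact: cvg_snd.
have cclip (g : R * R * R -> R) : continuous g ->
    continuous (fun z => clip z.1.1 (g z)).
  move=> cg z; apply: (@continuous_min _ _
    (fun z => Num.max 0 (g z)) (fun z => ceiling z.1.1)).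
    by apply: (@continuous_max _ _ (cst 0) g); [exact: cst_continuous|exact: cg].
  apply: cvgMl; apply: cvgD; first exact: cvg_cst.
  apply: (@cvg_comp _ _ _ (fun z => z.1.1) (krn alpha) _ (nbhs z.1.1)).
    exact: c1.
  exact: krn_continuous.
have := @continuous_within_comp _ _ _ _ _
  (fun z : R * R * R => (Num.max 0 z.1.1, clip z.1.1 z.1.2, clip z.1.1 z.2)) f_cont.
apply.
  move=> z; apply: (cvg_pair (cvg_pair _ (cclip _ c2 z)) (cclip _ c3 z)).
  by apply: (@continuous_max _ _ (cst 0) (fun z : R * R * R => z.1.1));
    [exact: cst_continuous|exact: c1].
move=> z /=; split; first by rewrite le_max lexx.
  by have /andP[] := clip_itv z.1.1 z.1.2.
by have /andP[] := clip_itv z.1.1 z.2.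
Qed.

(** By continuity the truncation at (s, 0, 0) is nonzero for s near some t0. A vanishing fractional
    integral beyond that neighbourhood would make the nonnegative integrand null there, hence [a]
    null almost everywhere on an interval. *)
Lemma truncated_nontrivial (gam : R) (a : R -> R) : 0 < gam ->
  (forall x y : R, 0 <= x -> x < y -> exists2 t, x < t < y & f t 0 0 <> 0) ->
  (forall t : R, 0 <= t -> 0 <= a t) ->
  (forall x y : R, 0 <= x -> x < y ->
     ~ {ae @lebesgue_measure R, forall t, x <= t <= y -> a t = 0}) ->
  (forall t : R, 0 <= t -> RLint_exists gam a t) ->
  ~ (forall t, 0 <= t -> RLint gam (fun s => a s * truncated s 0 0) t = 0).
Proof.
move=> gam0 f_neq0 a0 a_neq0 ia nz.
have [t0 /andP[t01 _] ft0] := f_neq0 1 2 ler01 (ltr1n _ 2).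
have cF : continuous (fun s => truncated s 0 0).
  move=> s; have pc : (r, 0 : R, 0 : R) @[r --> s] --> (s, 0 : R, 0 : R).
    exact: (cvg_pair (cvg_pair (@cvg_id _ (nbhs s)) (cvg_cst 0)) (cvg_cst 0)).
  have := cvg_comp _ _ pc (@continuous_truncated (s, 0, 0)); exact.
have z0 t : 0 <= (0 : R) <= ceiling t by rewrite lexx ceiling_ge0.
have Ft0 : truncated t0 0 0 != 0.
  by rewrite truncatedE//; [exact/eqP|lra].
have /cvgrPdist_lt/(_ `|truncated t0 0 0|) := cF t0.
rewrite normr_gt0 => /(_ Ft0)[d /= d0 hd].
(* As t0 > 1, the bound e <= 1 keeps [t0 - e, t0 + e] in the half line. *)
pose e := Num.min (d / 2) 1.
have e0 : 0 < e by rewrite lt_min ltr01 divr_gt0.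
have e1 : e <= 1 by rewrite ge_min lexx orbT.
have ed : e < d by rewrite gt_min ltr_pdivrMr// ltr_pMr// ltr1n.
apply: (a_neq0 (t0 - e) (t0 + e)); [lra|lra|].
(* [T] lies strictly to the right of the interval, so the kernel does not vanish on it. *)
pose T := t0 + e + 1.
have T0 : 0 <= T by rewrite /T; lra.
pose g s := (T - s) `^ (gam - 1) * (a s * truncated s 0 0).
have mF : measurable_fun setT (fun s => truncated s 0 0).
  exact: continuous_measurable_fun.
have ma : measurable_fun (`[0, T] : set R) a.
  apply: measurable_funS (RLint_exists_measurable ia) => //.
  by move=> s /=; rewrite !in_itv/= => /andP[->].
have mag : measurable_fun (`[0, T] : set R) (fun s => a s * truncated s 0 0).
  by apply: measurable_funM => //; exact: measurable_funTS.
have ig : RLint_exists gam (fun s => a s * truncated s 0 0) T.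
  apply: (@RLint_exists_mulr _ _ _ _ (Bsup alpha f delta)) => // [|s _]; first exact: ia.
  by have /andP[h0 h1] := truncated_itv s 0 0; rewrite ger0_norm.
have ge0 s : 0 <= s -> 0 <= a s * truncated s 0 0.
  by move=> s0; rewrite mulr_ge0 ?a0//; have /andP[] := truncated_itv s 0 0.
have gint : (\int[@lebesgue_measure R]_(s in `[0%R, T]) `|(g s)%:E| = 0)%E.
  transitivity (\int[@lebesgue_measure R]_(s in `[0%R, T]) (g s)%:E)%E.
    apply: eq_integral => s; rewrite inE/= in_itv/= => /andP[s0 _].
    by rewrite /= ger0_norm// mulr_ge0 ?powR_ge0 ?ge0.
  have := congr1 EFin (nz T T0); rewrite (EFin_RLint ig) => /eqP.
  rewrite mule_eq0 => /orP[|/eqP//].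
  by rewrite eqe invr_eq0 (negbTE (Gamma_neq0 gam0)).
have mg : measurable_fun (`[0, T] : set R) (fun s => (g s)%:E).
  by apply/measurable_EFinP/measurable_funM => //; exact: measurable_powR_subl.
have := (ae_eq_integral_abs (@lebesgue_measure R) (measurable_itv `[0, T]) mg).1 gint.
have FF : Filter (almost_everywhere (@lebesgue_measure R)) :=
  ae_filter_ringOfSetsType (@lebesgue_measure R).
apply: filterS => s gs /andP[s1 s2].
have : `[0, T]%classic s by rewrite /= in_itv/=; apply/andP; split; rewrite /T; lra.
move=> /gs /= -[] /eqP; rewrite /g !mulf_eq0 => /or3P[|/eqP//|].
  by rewrite powR_eq0 => /andP[/eqP Ts _]; move: s2; rewrite /T in Ts; lra.
move=> /eqP Fs; have : `|t0 - s| < d.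
  by rewrite (le_lt_trans _ ed)// ler_norml; apply/andP; split; lra.
by move=> /hd /=; rewrite Fs subr0 ltxx.
Qed.

End Truncation.

Theorem theorem3p1 (R : realType) (p q gamma alpha beta : R)
  (hp : 1 < p) (hpq : p^-1 + q^-1 = 1)
  (hgamma : 0 < gamma <= 1) (halpha : 2 < alpha <= 3) (hbeta : 0 < beta)
  (m : nat) (hm : (3 <= m)%N)
  (xi eta : 'I_(m - 2) -> R)
  (hxi_pos : forall i, 0 < xi i)
  (hxi_incr : forall i j : 'I_(m - 2), (i < j)%N -> xi i < xi j)
  (heta_pos : forall i, 0 < eta i)
  (hsum : 0 < \sum_(i < m - 2) eta i * xi i `^ (alpha + beta - 2)
            < Gamma (alpha + beta - 1))
  (f : R -> R -> R -> R)
  (hf_ge0 : forall t x y : R, 0 <= t -> 0 <= x -> 0 <= y -> 0 <= f t x y)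
  (hf_cont : {within [set z : R * R * R |
                        [/\ 0 <= z.1.1, 0 <= z.1.2 & 0 <= z.2]],
              continuous (fun z : R * R * R => f z.1.1 z.1.2 z.2)})
  (hf_neq0 : forall x y : R, 0 <= x -> x < y ->
     exists2 t, x < t < y & f t 0 0 <> 0)
  (hf_bnd : forall K : R, exists C : R, forall t u v : R,
     0 <= t -> 0 <= u <= K -> 0 <= v <= K ->
     f t ((1 + t `^ (alpha - 1)) * u) ((1 + t `^ (alpha - 1)) * v) <= C)
  (a : R -> R)
  (ha_ge0 : forall t : R, 0 <= t -> 0 <= a t)
  (ha_neq0 : forall x y : R, 0 <= x -> x < y ->
     ~ {ae @lebesgue_measure R, forall t, x <= t <= y -> a t = 0})
  (ha_RLint : forall t : R, 0 <= t -> RLint_exists gamma a t)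
  (ha_RLcont : {within `[0, +oo[, continuous (RLint gamma a)})
  (ha_int : (\int[@lebesgue_measure R]_(s in `[0%R, +oo[)
               (phi q (RLint gamma a s))%:E < +oo)%E)
  (delta : R) (hdelta : 0 < delta)
  (hM : 1 <= delta / Mconst q gamma alpha beta xi eta a f delta) :
  exists u : R -> R,
    is_positive_solution p gamma alpha beta xi eta a f u /\
    forall t : R, 0 <= t ->
      0 <= u t / (1 + t `^ (alpha - 1)) <= delta /\
      0 <= hderive u t / (1 + t `^ (alpha - 1)) <= delta.
Proof.
have p0 : 0 < p by exact: lt_trans hp.
have qV : q^-1 = 1 - p^-1 by rewrite -hpq addrAC subrr add0r.
have q1 : 1 < q.
  have : 0 < q^-1 < 1.
    by rewrite qV subr_gt0 invf_lt1// hp gtrBl invr_gt0.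
  by move=> /andP[+ q1]; rewrite invr_gt0 => q0; rewrite -invf_lt1.
have q0 : 0 < q by exact: lt_trans q1.
have pq : (p - 1) * (q - 1) = 1.
  have pn0 := lt0r_neq0 p0; have qn0 := lt0r_neq0 q0.
  have e : q + p = p * q by rewrite -[RHS]mulr1 -hpq; field; rewrite pn0 qn0.
  by rewrite mulrBl mul1r mulrBr mulr1 -e; ring.
have /andP[gam0 gam1] := hgamma; have /andP[al2 al3] := halpha.
have al1 : 1 < alpha by lra.
have [A [aA [A1 A2]]] : exists A, A + 1 = alpha /\ 1 < A /\ A <= 2.
  by exists (alpha - 1); split; [ring|split; lra].
have A0 : 0 < A by lra.
have a_cont : continuous (RLint gamma a).
  apply: hcont_continuous; last by move=> t t0; rewrite !RLint_le0.
  move=> t t0; have /subspace_continuousP/(_ t) := ha_RLcont.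
  rewrite /= in_itv/= andbT => /(_ t0); apply: cvg_trans; apply: cvg_app.
  by apply: within_subset => s /=; rewrite in_itv/= andbT.
have R0 s : 0 <= s -> 0 <= RLint gamma a s.
  by move=> s0; apply: RLint_ge0 => // r /andP[r0 _]; exact: ha_ge0.
set B := Bsup alpha f delta in hM.
pose F := truncated alpha delta f.
have F_bnd t x y : 0 <= F t x y <= B by exact: truncated_itv.
have F_cont : continuous (fun z : R * R * R => F z.1.1 z.1.2 z.2).
  exact: continuous_truncated.
have B0 : 0 <= B by have /andP[h0 h1] := F_bnd 0 0 0; exact: le_trans h1.
pose J := \int[@lebesgue_measure R]_(s in `[0, +oo[) phi q (RLint gamma a s).
have iphi : (@lebesgue_measure R).-integrable `[0, +oo[
    (EFin \o (fun s => krn q (RLint gamma a s))).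
  apply/integrableP; split.
    apply/measurable_EFinP; apply: measurable_funTS; apply: continuous_measurable_fun.
    move=> s; apply: (@cvg_comp _ _ _ (RLint gamma a) (krn q) _ (nbhs (RLint gamma a s))).
      exact: a_cont.
    exact: krn_continuous.
  apply: le_lt_trans ha_int; rewrite le_eqVlt; apply/orP; left; apply/eqP.
  apply: eq_integral => s; rewrite inE/= in_itv/= andbT => s0.
  by rewrite /= ger0_norm ?krn_ge0// phiE// R0.
have maj s : 0 <= s -> majorant gamma q B a s = krn q B * krn q (RLint gamma a s).
  by move=> s0; rewrite /majorant krnM// R0.
have int_maj : (@lebesgue_measure R).-integrable `[0, +oo[ (EFin \o majorant gamma q B a).
  have := @integrableZl _ _ _ (@lebesgue_measure R) _ (measurable_itv `[0, +oo[) (krn q B) _ iphi.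
  apply: eq_integrable => // s; rewrite inE/= in_itv/= andbT => s0.
  by rewrite maj.
have Imaj : \int[@lebesgue_measure R]_(s in `[0, +oo[) majorant gamma q B a s = phi q B * J.
  rewrite phiE// /J.
  have -> : \int[@lebesgue_measure R]_(s in `[0, +oo[) phi q (RLint gamma a s) =
      \int[@lebesgue_measure R]_(s in `[0, +oo[) krn q (RLint gamma a s).
    by apply: eq_Rintegral => s; rewrite inE/= in_itv/= andbT => s0; rewrite phiE// R0.
  rewrite -(@RintegralZl _ _ _ (@lebesgue_measure R) `[0, +oo[ _ _ (measurable_itv _) iphi).
  by apply: eq_Rintegral => s; rewrite inE/= in_itv/= andbT => /maj.
have wE : weight A beta xi eta = \sum_(i < m - 2) eta i * xi i `^ (alpha + beta - 2).
  by apply: eq_bigr => i _; congr (_ * _ `^ _); rewrite -aA; ring.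
have AbE : A + beta = alpha + beta - 1 by rewrite -aA; ring.
have /andP[_ wlt] := hsum; rewrite -wE -AbE in wlt.
have [c [v [/andP[c0 cmax] cv cs vf]]] := existence A1 A2 gam0 q1 ha_ge0 ha_RLint a_cont
  F_bnd F_cont int_maj hbeta hxi_pos heta_pos wlt.
pose u := antider v.
have GA := Gamma_gt0 A0.
have GAb : 0 < Gamma (A + beta) by rewrite Gamma_gt0// addr_gt0.
(* The factor alpha - 1 of M cancels against Gamma alpha = (alpha - 1) Gamma (alpha - 1). *)
have ME : Mconst q gamma alpha beta xi eta a f delta =
    slope_max A gamma q B a beta xi eta / Gamma A.
  rewrite /Mconst /Lconst /slope_max Imaj -/J -/B -wE -AbE -aA GammaS//.
  by rewrite addrK; apply: slope_max_divE; [exact: GA|exact: GAb|exact: A0|exact: wlt].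
have Mle : slope_max A gamma q B a beta xi eta / Gamma A <= delta.
  rewrite -ME; have [M0|M0] := ltP 0 (Mconst q gamma alpha beta xi eta a f delta).
    by move: hM; rewrite ler_pdivlMr// mul1r.
  (* Division by 0 gives 0, so [hM] rules out M = 0 too. *)
  have : delta / Mconst q gamma alpha beta xi eta a f delta <= 0.
    by rewrite mulr_ge0_le0 ?(ltW hdelta)// invr_le0.
  by move=> /(le_trans hM); rewrite ler10.
have cle : c / Gamma A <= delta.
  by apply: le_trans Mle; apply: ler_wpM2r; [rewrite invr_ge0 ltW|exact: cmax].
(* Used for u' with x = A and for u with x = A + 1; the comparison of Gamma values lets the single
   bound on c serve both. *)
have bnds t x : 0 <= t -> 1 < x -> Gamma A <= Gamma x ->
    0 <= profile c (forcing gamma q a F v) x t <= delta * t `^ (x - 1).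
  move=> t0 x1 Gx.
  have := profile_bounds A1 gam0 q1 ha_ge0 ha_RLint a_cont F_bnd F_cont int_maj
    hbeta hxi_pos heta_pos wlt cv cs x1 t0.
  move=> /andP[-> /le_trans]; apply; apply: ler_wpM2r; first exact: powR_ge0.
  apply: le_trans cle; apply: ler_wpM2l; first exact: c0.
  by rewrite lef_pV2 ?posrE; [exact: Gx|exact: lt_le_trans GA Gx|exact: GA].
have vP t : 0 <= t -> v t = profile c (forcing gamma q a F v) A t.
  by move=> t0; apply: (velocity_profile A1 gam0 q1 ha_ge0 ha_RLint a_cont F_bnd F_cont cv vf).
have uP t : 0 <= t -> u t = profile c (forcing gamma q a F v) (A + 1) t.
  by move=> t0; apply: (antider_profile A1 gam0 q1 ha_ge0 ha_RLint a_cont F_bnd F_cont cv vf).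
have A11 : 1 < A + 1 by rewrite ltrDr.
have ceilE t : 0 <= t -> ceiling alpha delta t = delta * (1 + t `^ A).
  by move=> t0; rewrite /ceiling krnE// -aA addrK mulrC.
have vb t : 0 <= t -> 0 <= v t <= ceiling alpha delta t.
  move=> t0; rewrite vP// ceilE//; have /andP[-> /le_trans] := bnds t A t0 A1 (lexx _).
  by apply; rewrite ler_wpM2l ?(ltW hdelta)// powRB1_le.
have ub t : 0 <= t -> 0 <= u t <= ceiling alpha delta t.
  move=> t0; have GA1 : Gamma A <= Gamma (A + 1).
    by rewrite GammaS// ler_peMl ?(ltW GA)// ltW.
  rewrite uP// ceilE//; have /andP[-> /le_trans] := bnds t (A + 1) t0 A11 GA1.
  by apply; rewrite addrK ler_wpM2l ?(ltW hdelta)// lerDr.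
have Ff t : 0 <= t -> F t (u t) (v t) = f t (u t) (v t).
  by move=> t0; rewrite /F truncatedE ?ub ?vb.
exists u; split; last first.
  move=> t t0; have hu := hderive_antider cv t0.
  have K0 : 0 < 1 + t `^ (alpha - 1) by rewrite ltr_wpDr ?powR_ge0.
  have cE : ceiling alpha delta t = delta * (1 + t `^ (alpha - 1)).
    by rewrite ceilE// -aA addrK.
  rewrite hu.2 !divr_ge0 ?(ltW K0)//=; [|by case/andP: (vb t t0)|by case/andP: (ub t t0)].
  by rewrite !ler_pdivrMr// -cE; split; [case/andP: (ub t t0)|case/andP: (vb t t0)].
split; last first.
  apply: (antider_gt0 A1 gam0 q1 ha_ge0 ha_RLint a_cont F_bnd F_cont int_maj
    hbeta hxi_pos heta_pos wlt cv c0 cs vf).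
  exact: truncated_nontrivial.
rewrite -{1}aA; apply: (is_solution_antider A1 gam0 q1 ha_ge0 ha_RLint a_cont F_bnd F_cont
  int_maj hbeta hxi_pos wlt cv cs vf gam1 pq Ff).
Qed.
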